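(* Let $\Omega\subset\mathbb{R}^d\setminus\{0\}$ be a domain and let $u\in\mathcal{BV}_{\mathcal H_a}(\Omega)$. There exists a unique $\mathbb{R}^d$-valued finite Radon measure $\mu_{\mathcal H_a}$ on $\Omega$ such that $$\int_\Omega u(x)\,\mathrm{div}_{\mathcal H_a}\varphi(x)\,dx=\int_\Omega\varphi(x)\cdot d\mu_{\mathcal H_a}(x)$$ for every $\varphi\in C_c^\infty(\Omega,\mathbb{R}^d)$, and $$|\nabla_{\mathcal H_a}u|(\Omega)=|\mu_{\mathcal H_a}|(\Omega),$$ where $|\mu_{\mathcal H_a}|$ is the total variation of the measure $\mu_{\mathcal H_a}$.
   Context: Let $d\ge 2$, $a\ge -(\frac d2-1)^2$, $\sigma:=\frac{d-2}{2}-\frac12\sqrt{(d-2)^2+4a}$. For $1\le i\le d$ put $A_{-i,a}=\frac{\partial}{\partial x_i}-\sigma\frac{x_i}{|x|^2}$, and for $\varphi=(\varphi_1,\dots,\varphi_d)\in C_c^1(\Omega,\mathbb{R}^d)$ let $\mathrm{div}_{\mathcal H_a}\varphi=\sum_{i=1}^dA_{-i,a}\varphi_i$. The $\mathcal H_a$-variation of $f\in L^1(\Omega)$ is $|\nabla_{\mathcal H_a}f|(\Omega)=\sup\int_\Omega f\,\mathrm{div}_{\mathcal H_a}\varphi\,dx$ over $\varphi\in C_c^1(\Omega,\mathbb{R}^d)$ with $\sup_{x\in\Omega}|\varphi(x)|\le1$; $\mathcal{BV}_{\mathcal H_a}(\Omega)$ is the set of $f\in L^1(\Omega)$ with $|\nabla_{\mathcal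 H_a}f|(\Omega)<\infty$. *)

(* Defs.v *)
From HB Require Import structures.
From mathcomp Require Import all_boot all_order all_algebra.
From mathcomp Require Import all_classical all_reals all_analysis.
From mathcomp Require Import measurable_realfun.

Set Implicit Arguments.
Unset Strict Implicit.
Unset Printing Implicit Defensive.

Import Order.TTheory GRing.Theory Num.Theory.
Import numFieldNormedType.Exports.

Local Open Scope classical_set_scope.
Local Open Scope ring_scope.

Section borel_matrix.
Context {R : realType} {m n : nat}.

Let borel := <<s @open 'M[R]_(m, n) >>.

Let borel0 : borel set0. Proof. exact: sigma_algebra0. Qed.

Let borelC A : borel A -> borel (~` A). Proof. exact: sigma_algebraC. Qed.

Let borel_bigcup (F : (set 'M[R]_(m, n))^nat) :
  (forall i, borel (F i)) -> borel (\bigcup_i F i).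
Proof. exact: sigma_algebra_bigcup. Qed.

HB.instance Definition _ := @isMeasurable.Build
  (sigma_display (@open 'M[R]_(m, n))) 'M[R]_(m, n) borel
  borel0 borelC borel_bigcup.

End borel_matrix.

Section lebesgue_measure_rV.
Context {R : realType}.

Lemma open_measurable_mx m n (U : set 'M[R]_(m, n)) : open U -> measurable U.
Proof. exact: sub_sigma_algebra. Qed.

Definition rV_cons n (p : R * 'rV[R]_n) : 'rV[R]_n.+1 :=
  row_mx (p.1%:M : 'rV[R]_1) p.2.

Lemma rV_cons0 n (p : R * 'rV[R]_n) : rV_cons p 0 ord0 = p.1.
Proof.
have -> : ord0 = lshift n (0 : 'I_1) by apply/val_inj.
by apply: (etrans (row_mxEl _ _ _ _)); rewrite !mxE eqxx mulr1n.
Qed.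

Lemma rV_consS n (p : R * 'rV[R]_n) (i : 'I_n) :
  rV_cons p 0 (lift ord0 i) = p.2 0 i.
Proof.
have -> : lift ord0 i = rshift 1 i by apply/val_inj.
exact: row_mxEr.
Qed.

Let qball n (q : 'rV[rat]_n * nat) : set 'rV[R]_n :=
  ball (map_mx ratr q.1 : 'rV[R]_n) q.2.+1%:R^-1.

Lemma open_bigcup_ball n (U : set 'rV[R]_n) : open U ->
  U = \bigcup_(q in [set q | qball q `<=` U]) qball q.
Proof.
move=> oU; apply/seteqP; split => [x Ux|x [q qU xq]]; last exact: qU.
have /nbhs_ballP[e /= e0 xeU] : nbhs x U by exact: open_nbhs_nbhs.
have [k kE] : exists k : nat, k.+1%:R^-1 < e / 2.
  have e2 : 0 < e / 2 by rewrite divr_gt0.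
  have [k _ /(_ k (leqnn k))] := near_infty_natSinv_lt (PosNum e2).
  by move=> ?; exists k.
have k0 : 0 < k.+1%:R^-1 :> R by rewrite invr_gt0.
have Hq i : exists r : rat, ball (x 0 i) k.+1%:R^-1 (ratr r).
  have [r] : exists r, ratr r \in `](x 0 i), (x 0 i + k.+1%:R^-1)[.
    by apply: rat_in_itvoo; rewrite ltrDl.
  rewrite in_itv/= => /andP[xr rx]; exists r.
  by rewrite /ball/= distrC gtr0_norm ?subr_gt0// ltrBlDl.
pose q : 'rV[rat]_n := \row_i sval (cid (Hq i)).
have xq : ball x k.+1%:R^-1 (map_mx ratr q : 'rV[R]_n).
  split=> // i j; rewrite !mxE (ord1 i); exact: (svalP (cid (Hq j))).
exists (q, k); last exact: ball_sym.
move=> y qy; apply: xeU.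
apply: (@le_ball _ _ x (k.+1%:R^-1 + k.+1%:R^-1)).
  by rewrite [leRHS]splitr lerD// ltW.
exact: ball_triangle xq qy.
Qed.

Lemma measurable_rV_cons n : measurable_fun setT (@rV_cons n).
Proof.
apply: (@measurability _ _ _ _ _ _ (@open 'rV[R]_n.+1)) => //.
move=> _ [U oU <-]; rewrite setTI (open_bigcup_ball oU) preimage_bigcup.
rewrite bigcup_mkcond.
apply: countable_bigcupT_measurable => [|[q k]]; first exact: countableP.
case: ifP => // _.
have k0 : 0 < k.+1%:R^-1 :> R by rewrite invr_gt0.
rewrite (_ : _ @^-1` _ = (ball (ratr (q 0 ord0) : R) k.+1%:R^-1) `*`
   qball (\row_i q 0 (lift ord0 i), k)).
  apply: measurableX; first by apply: open_measurable; exact: ball_open.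
  by apply: open_measurable_mx; exact: ball_open.
apply/seteqP; split => [p [_ qp]|p [/= p1 [_ p2]]].
  split=> /=.
    by have := qp 0 ord0; rewrite rV_cons0 mxE.
  split=> // i j; rewrite (ord1 i) !mxE.
  by have := qp 0 (lift ord0 j); rewrite rV_consS mxE.
split=> // i j; rewrite (ord1 i) mxE.
have [->|[j' ->]] : j = ord0 \/ exists j', j = lift ord0 j'.
  by case: (unliftP ord0 j) => [j' ->|->]; [right; exists j'|left].
  by rewrite rV_cons0.
by rewrite rV_consS; have := p2 0 j'; rewrite !mxE.
Qed.

Lemma measurable_coord m n i j :
  measurable_fun setT (fun M : 'M[R]_(m, n) => M i j).
Proof.
apply: (measurability _ (RGenOpens.measurableE R)).
move=> _ [_ [a [b ->]] <-]; rewrite setTI; apply: open_measurable_mx.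
apply: open_comp => [x _|]; first exact: coord_continuous.
exact: interval_open.
Qed.

Lemma measurable_rV_uncons n : measurable_fun setT
  (fun x : 'rV[R]_n.+1 => (x 0 ord0, rsubmx (x : 'rV[R]_(1 + n)))).
Proof.
apply: measurable_fun_pair => /=; first exact: measurable_coord.
apply: (@measurability _ _ _ _ _ _ (@open 'rV[R]_n)) => //.
move=> _ [U oU <-]; rewrite setTI; apply: open_measurable_mx.
by apply: open_comp => // x _; exact: continuous_rsubmx.
Qed.

Lemma rV_consK n (p : R * 'rV[R]_n) : 
  (rV_cons p 0 ord0, rsubmx (rV_cons p : 'rV[R]_(1 + n))) = p.
Proof. by rewrite rV_cons0 row_mxKr -surjective_pairing. Qed.

Local Open Scope ereal_scope.

Section lebesgue_rV_step.
Variables (n : nat) (mu : {sigma_finite_measure set 'rV[R]_n -> \bar R}).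

Definition lebesgue_rV_step : set 'rV[R]_n.+1 -> \bar R :=
  pushforward (@lebesgue_measure R \x mu) (@rV_cons n).

Let nu : {measure set 'rV[R]_n.+1 -> \bar R} :=
  measure_function_pushforward__canonical__measure_function_Measure
    (@lebesgue_measure R \x mu) (@measurable_rV_cons n).

HB.instance Definition _ := Measure.copy lebesgue_rV_step nu.

Let lebesgue_rV_step_sigma_finite : sigma_finite setT lebesgue_rV_step.
Proof.
have [F TF Foo] : sigma_finite setT (@lebesgue_measure R \x mu).
  have /sigma_finiteP[F [TF ndF Foo]] := sigma_finiteT (@lebesgue_measure R).
  have /sigma_finiteP[G [TG ndG Goo]] := sigma_finiteT mu.
  exists (fun k => F k `*` G k) => [|k].
    rewrite -setXTT TF TG predeqE => -[x y]; split => [|[n' _ []/= ? ?]].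
      move=> [/= [i _ Fi] [j _ Gj]]; exists (maxn i j) => //; split.
      - by move: x Fi; exact/subsetPset/ndF/leq_maxl.
      - by move: y Gj; exact/subsetPset/ndG/leq_maxr.
    by split; exists n'.
  have [? ?] := Foo k; have [? ?] := Goo k; split; first exact: measurableX.
  by rewrite product_measure1E// lte_mul_pinfty// ge0_fin_numE.
exists (fun k => [set x : 'rV[R]_n.+1 |
    F k (x 0%R ord0, rsubmx (x : 'rV[R]_(1 + n)))]) => [|k].
  apply/esym/seteqP; split => // x _.
  have : setT (x 0%R ord0, rsubmx (x : 'rV[R]_(1 + n))) by [].
  by rewrite TF => -[k _ Fk]; exists k.
have [mF Fk] := Foo k; split.
  by rewrite -[X in measurable X]setTI; exact: measurable_rV_uncons.
rewrite /lebesgue_rV_step /pushforward.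
rewrite (_ : _ @^-1` _ = F k)//.
by apply/seteqP; split => p /=; rewrite rV_consK.
Qed.

HB.instance Definition _ := Measure_isSigmaFinite.Build _ _ _
  lebesgue_rV_step lebesgue_rV_step_sigma_finite.

End lebesgue_rV_step.

Fixpoint lebesgue_rV n : {sigma_finite_measure set 'rV[R]_n -> \bar R} :=
  if n is n'.+1 then lebesgue_rV_step (lebesgue_rV n') else \d_ (0%R : 'rV[R]_0).

Lemma lebesgue_rV_box n (A : 'I_n -> set R) : (forall i, measurable (A i)) ->
  lebesgue_rV n [set x : 'rV[R]_n | forall i, A i (x 0%R i)] =
  \prod_(i < n) lebesgue_measure (A i).
Proof.
elim: n A => [|n IH] A mA.
  by rewrite big_ord0 /= diracE mem_set// => -[].
rewrite big_ord_recl -(IH (fun i => A (lift ord0 i)))//=.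
have mB : measurable [set x : 'rV[R]_n | forall i, A (lift (ord0 : 'I_n.+1) i) (x 0%R i)].
  rewrite (_ : [set x | _] = \bigcap_(i in [set: 'I_n])
      ((fun x : 'rV[R]_n => x 0%R i) @^-1` A (lift ord0 i))).
    apply: fin_bigcap_measurable => [|i _]; first exact: finite_finset.
    by rewrite -[X in measurable X]setTI; exact: measurable_coord.
  by apply/seteqP; split => [x Ax i _|x Ax i]; [exact: Ax|exact: Ax].
rewrite /lebesgue_rV_step /pushforward .
have := product_measure1E (@lebesgue_measure R) (lebesgue_rV n) (mA ord0) mB.
move=> <-.
congr ((_ \x _) _).
apply/seteqP; split => [p /= Ap|p /= [p1 p2] i].
  by split=> [|i]; [have := Ap ord0|have := Ap (lift ord0 i)];
    rewrite ?rV_cons0 ?rV_consS.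
by case: (unliftP ord0 i) => [j ->|->]; rewrite ?rV_consS ?rV_cons0.
Qed.

End lebesgue_measure_rV.

Section hardy.
Context {R : realType} {d : nat}.
Local Notation E := 'rV[R]_d.
Implicit Types (Omega A : set E) (u : E -> R) (phi : E -> E).

(* The library's norm on ['rV[R]_d] is the maximum norm; [|x|] is Euclidean. *)
Definition enorm (x : E) : R := Num.sqrt (\sum_i x 0 i ^+ 2).

Definition is_domain Omega := [/\ open Omega, connected Omega & Omega !=set0].

Definition partial_deriv (i : 'I_d) (f : E -> R) : E -> R := 'D_(delta_mx 0 i) f.

Fixpoint Ck (k : nat) (f : E -> R) : Prop :=
  if k is k'.+1 then
    continuous f /\ forall i,
      (forall x, derivable f x (delta_mx 0 i)) /\ Ck k' (partial_deriv i f)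
  else continuous f.

(* Elements of [C_c^k(Omega, R^d)], extended by 0 outside of [Omega]. *)
Definition Ckc (k : nat) Omega phi :=
  [/\ forall i, Ck k (fun x => phi x 0 i),
      compact (closure [set x | phi x != 0]) &
      closure [set x | phi x != 0] `<=` Omega].

Definition Cinfc Omega phi := forall k, Ckc k Omega phi.

Definition hardy_sigma (a : R) : R :=
  (d%:R - 2) / 2 - Num.sqrt ((d%:R - 2) ^+ 2 + 4 * a) / 2.

Definition A_H (a : R) (i : 'I_d) (f : E -> R) (x : E) : R :=
  partial_deriv i f x - hardy_sigma a * (x 0 i / enorm x ^+ 2) * f x.

Definition div_H (a : R) phi (x : E) : R :=
  \sum_i A_H a i (fun y => phi y 0 i) x.

Local Open Scope ereal_scope.

Definition variation_H (a : R) Omega u : \bar R :=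
  ereal_sup [set \int[lebesgue_rV d]_(x in Omega) (u x * div_H a phi x)%:E
    | phi in [set phi | Ckc 1 Omega phi /\
                        forall x, Omega x -> (enorm (phi x) <= 1)%R]].

(* [integrable] is over the Borel sets: an element of [L^1(Omega)] is
   given by a Borel representative. *)
Definition BV_H (a : R) Omega u :=
  (lebesgue_rV d).-integrable Omega (EFin \o u) /\ variation_H a Omega u < +oo.

End hardy.

Section vector_measure.
Context {R : realType} {d : nat}.
Local Notation E := 'rV[R]_d.
Implicit Types (Omega A K : set E) (mu : 'I_d -> {charge set E -> \bar R}).

Local Open Scope ereal_scope.

(* The choice of the Hahn decomposition is irrelevant, see
   [Hahn_decomposition_uniq]. *)
Definition charge_integral (nu : {charge set E -> \bar R}) (D : set E)
    (f : E -> R) : \bar R :=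
  let nuPN := svalP (cid (svalP (cid (Hahn_decomposition nu)))) in
  \int[jordan_pos nuPN]_(x in D) (f x)%:E
  - \int[jordan_neg nuPN]_(x in D) (f x)%:E.

Definition vector_integral mu (D : set E) (phi : E -> E) : \bar R :=
  \sum_i charge_integral (mu i) D (fun x => phi x 0%R i).

Definition vector_value mu A : E := \row_i fine (mu i A).

Definition vector_variation mu A : \bar R :=
  ereal_sup [set \sum_(0 <= k <oo) (enorm (vector_value mu (F k)))%:E
    | F in [set F : (set E)^nat | [/\ forall k, measurable (F k),
                                      trivIset setT F & \bigcup_k F k = A]]].

(* A measure on [Omega] is represented by the measure
   [A |-> mu (A `&` Omega)] on the Borel sets of R^d.  Charges take finite
   values, so finiteness on compact sets is automatic. *)
Definition finite_radon_measure Omega mu :=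
  (forall i A, measurable A -> mu i A = mu i (A `&` Omega)) /\
  (forall A, measurable A -> A `<=` Omega ->
    vector_variation mu A =
    ereal_sup [set vector_variation mu K | K in [set K | compact K /\ K `<=` A]]).

Definition represents_H (a : R) Omega (u : E -> R) mu :=
  forall phi, Cinfc Omega phi ->
    \int[lebesgue_rV d]_(x in Omega) (u x * div_H a phi x)%:E =
    vector_integral mu Omega phi.

End vector_measure.

(* Main.v *)
Require Import Defs.
From HB Require Import structures.
From mathcomp Require Import all_boot all_order all_algebra.
From mathcomp Require Import finmap ring lra.
From mathcomp Require Import all_classical all_reals all_analysis.
From mathcomp Require Import measurable_realfun.

Set Implicit Arguments.
Unset Strict Implicit.
Unset Printing Implicit Defensive.

Import Order.TTheory GRing.Theory Num.Theory.
Import numFieldNormedType.Exports.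

Local Open Scope classical_set_scope.
Local Open Scope ring_scope.

(** Write [L phi] for the integral over [Omega] of [u * div_H a phi]. On fields
    of class C^1 with compact support in [Omega] this is a linear functional,
    and it is bounded by [V = variation_H a Omega u] on fields of Euclidean norm
    at most [1]: the origin lies outside of [Omega], so [div_H a phi] is
    continuous with compact support there, hence bounded, and its product with
    the integrable [u] is integrable. The theorem is thus the Riesz
    representation of a bounded functional on vector fields, together with the
    equality of norms.

    The mass [open_mass U] of an open set is the supremum of [L] over the fields
    bounded by [1] with support in [U]. Its outer extension [outer_mass] makes
    open sets Caratheodory-measurable, so it restricts to a Borel measure [nu]
    of total mass at most [V] ([exists_mass_measure]). The main estimate is
    [functional_le_off]: splitting a field with a smooth cutoff shows that a
    field bounded by [c], and smaller than [dl] off an open [U], satisfies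
    [L phi <= c * nu U + dl * V].

    The charges come next. Approximate the trace of [A] on [Omega] by a compact
    [K] inside and an open [U] outside, with [nu (U `\` K)] small
    ([mass_regular]), and let [eta] be a cutoff that is [1] on [K] and supported
    in [U]. Two such cutoffs differ only on a set of small mass, so the values
    [L (eta e_i)] determine one number, which is [coord_measure i A]. Replacing
    the indicators in a step function by cutoffs gives [functional_step]: if a field is uniformly within [dl] of the
    step function with values [c_k] on [A_k], then [L] of it is within [dl * V]
    of the sum of the [c_k . mu (A_k)]. Everything else is read off from this
    inequality: finite additivity, the representation of [L] (the integrals
    against the charges satisfy the same kind of estimate,
    [charge_integral_near_step]), and [V <= |mu| (Omega)]. Conversely
    [|mu A| <= nu A] for the Euclidean norm ([enorm_coord_vector_le]), which
    gives countable additivity, [|mu| (Omega) <= V] and, with the regularity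
    of [nu], the Radon property.

    For uniqueness, an open set is exhausted by compacts; the corresponding
    smooth cutoffs converge boundedly to its indicator, so by dominated
    convergence two representing measures agree on open sets, and therefore on
    Borel sets ([charge_eq_of_smooth]). *)

(** * Preliminaries on limits, continuity and compact sets *)

Lemma ler_vanishing {R : realType} (x y D : R) :
  0 <= D -> (forall e, 0 < e -> x <= y + e * D) -> x <= y.
Proof.
move=> D0 h; apply/ler_addgt0Pr => e e0.
have D1 : 0 < D + 1 by rewrite ltr_wpDl.
apply: (le_trans (h (e / (D + 1)) (divr_gt0 e0 D1))).
by rewrite lerD2l -mulrA ler_piMr ?(ltW e0)// mulrC ler_pdivrMr// mul1r lerDl.
Qed.

Section continuous_algebra.
Context {R : realType} {T : topologicalType}.
Implicit Types f g : T -> R.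

Lemma continuous_add f g :
  continuous f -> continuous g -> continuous (fun x => f x + g x).
Proof. by move=> cf cg x; exact: (continuousD (cf x) (cg x)). Qed.

Lemma continuous_mul f g :
  continuous f -> continuous g -> continuous (fun x => f x * g x).
Proof. by move=> cf cg x; exact: (continuousM (cf x) (cg x)). Qed.

Lemma continuous_inv f : (forall x, f x != 0) ->
  continuous f -> continuous (fun x => (f x)^-1).
Proof. by move=> f0 cf x; exact: (continuousV (f0 x) (cf x)). Qed.

Lemma continuous_at_sum (x : T) (I : Type) (s : seq I) (F : I -> T -> R) :
  (forall i, {for x, continuous (F i)}) ->
  {for x, continuous (fun y => \sum_(i <- s) F i y)}.
Proof.
move=> cF; elim: s => [|i s IH].
  rewrite (_ : (fun _ => _) = fun=> 0); first exact: cst_continuous.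
  by apply/funext => y; rewrite big_nil.
rewrite (_ : (fun _ => _) = fun y => F i y + \sum_(j <- s) F j y).
  exact: (continuousD (cF i) IH).
by apply/funext => y; rewrite big_cons.
Qed.

Lemma continuous_sum (I : Type) (s : seq I) (F : I -> T -> R) :
  (forall i, continuous (F i)) -> continuous (fun x => \sum_(i <- s) F i x).
Proof. by move=> cF x; apply: continuous_at_sum => i; exact: cF. Qed.

End continuous_algebra.

Section compact_rV.
Context {R : realType} {d : nat}.
Implicit Types U K : set 'rV[R]_d.

Lemma compact_closed_rV K : compact K -> closed K.
Proof. by move=> cK; apply: compact_closed => //; exact: norm_hausdorff. Qed.

Lemma compactD_open U K : compact K -> open U -> compact (K `\` U).
Proof.
move=> cK oU; apply: (subclosed_compact _ cK); last exact: subDsetl.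
by rewrite setDE; apply: closedI; [exact: compact_closed_rV|exact: open_closedC].
Qed.

Lemma openD_compact U K : open U -> compact K -> open (U `\` K).
Proof.
move=> oU cK; rewrite setDE; apply: openI => //.
by apply: closed_openC; exact: compact_closed_rV.
Qed.

Lemma measurable_compact K : compact K -> measurable K.
Proof.
move=> cK; rewrite -[K]setCK; apply: measurableC; apply: open_measurable_mx.
by apply: closed_openC; exact: compact_closed_rV.
Qed.

End compact_rV.

(** * The algebra of functions of class C^k *)

Section Ck_algebra.
Context {R : realType} {d : nat}.
Local Notation E := 'rV[R]_d.
Implicit Types f g : E -> R.

Lemma Ck_continuous k f : Ck k f -> continuous f.
Proof. by case: k => [|k] // []. Qed.

Lemma CkW k f : Ck k.+1 f -> Ck k f.
Proof.
elim: k f => [|k IH] f; first by case.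
by move=> [cf df]; split => // i; have [? ?] := df i; split => //; exact: IH.
Qed.

Lemma Ck_cst k (c : R) : Ck k (fun _ : E => c).
Proof.
elim: k c => [|k IH] c; first exact: cst_continuous.
split=> [|i]; first exact: cst_continuous.
split=> [x|]; first exact: derivable_cst.
rewrite (_ : partial_deriv i _ = fun=> 0); first exact: IH.
by apply/funext => x; rewrite /partial_deriv derive_cst.
Qed.

Lemma Ck_add k f g : Ck k f -> Ck k g -> Ck k (fun x => f x + g x).
Proof.
elim: k f g => [|k IH] f g; first exact: continuous_add.
move=> [cf df] [cg dg]; split=> [|i]; first exact: continuous_add.
have [[dfi Cf] [dgi Cg]] := (df i, dg i); split=> [x|].
  exact: derivableD.
rewrite (_ : partial_deriv i _ = fun x => partial_deriv i f x + partial_deriv i g x).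
  exact: IH.
by apply/funext => x; rewrite /partial_deriv -deriveD.
Qed.

Lemma Ck_mul k f g : Ck k f -> Ck k g -> Ck k (fun x => f x * g x).
Proof.
elim: k f g => [|k IH] f g; first exact: continuous_mul.
move=> Cf Cg; have [Cf' Cg'] := (CkW Cf, CkW Cg).
move: Cf Cg => [cf df] [cg dg]; split=> [|i]; first exact: continuous_mul.
have [[dfi dCf] [dgi dCg]] := (df i, dg i); split=> [x|].
  exact: derivableM.
rewrite (_ : partial_deriv i _ =
    fun x => f x * partial_deriv i g x + g x * partial_deriv i f x).
  by apply: Ck_add; exact: IH.
by apply/funext => x; rewrite /partial_deriv deriveM.
Qed.

Lemma Ck_opp k f : Ck k f -> Ck k (fun x => - f x).
Proof.
move=> Cf; rewrite (_ : (fun x => - f x) = fun x => -1 * f x).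
  by apply: Ck_mul => //; exact: Ck_cst.
by apply/funext => x; rewrite mulN1r.
Qed.

Lemma Ck_inv k f : (forall x, f x != 0) -> Ck k f -> Ck k (fun x => (f x)^-1).
Proof.
move=> f0; elim: k => [|k IH]; first exact: continuous_inv.
move=> Cf; have Cf' := CkW Cf.
move: Cf => [cf df]; split=> [|i]; first exact: continuous_inv.
have [dfi dCf] := df i; split=> [x|]; first exact: derivableV.
rewrite (_ : partial_deriv i _ =
    fun x => - ((f x)^-1 * (f x)^-1) * partial_deriv i f x).
  by apply: Ck_mul => //; apply: Ck_opp; apply: Ck_mul; exact: IH.
by apply/funext => x; rewrite /partial_deriv deriveV// expr2 invfM.
Qed.

Lemma Ck_prod k (I : Type) (s : seq I) (F : I -> E -> R) :
  (forall i, Ck k (F i)) -> Ck k (fun x => \prod_(i <- s) F i x).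
Proof.
move=> CF; elim: s => [|i s IH].
  rewrite (_ : (fun _ => _) = fun=> 1); first exact: Ck_cst.
  by apply/funext => x; rewrite big_nil.
rewrite (_ : (fun _ => _) = fun x => F i x * \prod_(j <- s) F j x).
  exact: Ck_mul.
by apply/funext => x; rewrite big_cons.
Qed.

End Ck_algebra.

(** * A smooth function that is flat at the origin *)

Section flat_function.
Context {R : realType}.
Implicit Types (t h : R) (n : nat).

Lemma is_derive_near (f g : R -> R) (x df : R) :
  (\forall y \near x, f y = g y) -> is_derive x 1 f df -> is_derive x 1 g df.
Proof.
move=> fg [dfx dfE].
have gE : (fun h => h^-1 *: ((g \o shift x) (h *: 1) - g x)) @ 0^' --> df.
  rewrite -dfE; apply: cvg_trans dfx; apply: near_eq_cvg.
  have fgx : f x = g x by exact: nbhs_singleton fg.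
  have cs : (h *: 1 + x) @[h --> (0 : R)] --> x.
    rewrite -[X in _ --> X]add0r; apply: cvgD; last exact: cvg_cst.
    by rewrite -[X in _ --> X](scale0r 1); apply: cvgZr_tmp; exact: cvg_id.
  have /= fg' := cs _ fg.
  have : \forall h \near 0^', f (h *: 1 + x) = g (h *: 1 + x).
    exact: (nbhs_dnbhs fg').
  by apply: filterS => h /= ->; rewrite fgx.
by apply: DeriveDef; [apply/cvg_ex; exists df|exact: cvg_lim gE].
Qed.

(** The family is indexed by [n] because it is then closed under differentiation
    up to linear combinations, and a single computation gives smoothness. *)
Definition flat n t : R := if 0 < t then t^-1 ^+ n * expR (- t^-1) else 0.

Lemma flat_ge0 n t : 0 <= flat n t.
Proof.
rewrite /flat; case: ifPn => // t0.
by rewrite mulr_ge0 ?expR_ge0// exprn_ge0// invr_ge0 ltW.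
Qed.

Lemma flat_gt0 n t : 0 < t -> 0 < flat n t.
Proof.
by move=> t0; rewrite /flat t0 mulr_gt0 ?expR_gt0// exprn_gt0// invr_gt0.
Qed.

Lemma flat_le0 n t : t <= 0 -> flat n t = 0.
Proof. by rewrite /flat leNgt => /negbTE ->. Qed.

(** From [y^(n+1) / (n+1)! <= exp y] at [y = 1 / t]. The linear bound gives the
    derivative at [0], where the difference quotient of one member of the family
    is the next one. *)
Lemma flat_bound n t : `|flat n t| <= n.+1`!%:R * `|t|.
Proof.
rewrite ger0_norm ?flat_ge0// /flat; case: ifPn => [t0|_]; last first.
  by rewrite mulr_ge0.
rewrite gtr0_norm// expRN ler_pdivrMr ?expR_gt0//.
have /(expR_ge1Dxn n) : 0 <= t^-1 by rewrite invr_ge0 ltW.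
move=> /(le_trans _) => /(_ (t^-1 ^+ n.+1 / n.+1`!%:R)).
have -> : t^-1 ^+ n.+1 / n.+1`!%:R <= 1 + t^-1 ^+ n.+1 / n.+1`!%:R by rewrite lerDr.
move=> /(_ isT) le1.
apply: (@le_trans _ _ (n.+1`!%:R * t * (t^-1 ^+ n.+1 / n.+1`!%:R))).
  rewrite exprS [leRHS](_ : _ = t^-1 ^+ n)//.
  field.
  by rewrite pnatr_eq0 -lt0n fact_gt0 gt_eqF.
by apply: ler_wpM2l => //; rewrite mulr_ge0// ltW.
Qed.

Lemma is_derive_flat n t :
  is_derive t 1 (flat n) (flat n.+2 t - n%:R * flat n.+1 t).
Proof.
have [t0|t0|<-] := ltgtP 0 t.
- apply: (@is_derive_near (fun s => s^-1 ^+ n * expR (- s^-1))).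
    have := lt_nbhsr t0.
    by apply: filterS => s s0; rewrite /flat s0.
  have tn0 : t != 0 by rewrite gt_eqF.
  have dV : is_derive t 1 (fun s : R => s^-1) (- t ^- 2).
    by apply: is_derive_eq; [exact: is_deriveV|rewrite [LHS]mulr1].
  have dX : is_derive t 1 (fun s : R => s^-1 ^+ n)
      ((n%:R * t^-1 ^+ n.-1) *: - t ^- 2).
    have := @is_deriveX _ _ (fun s : R => s^-1) n t 1 _ dV.
    by congr (is_derive _ _ _ _); apply/funext => s; rewrite exprfctE.
  have dN : is_derive t 1 (fun s : R => - s^-1) (t ^- 2).
    by have := is_deriveN dV; rewrite opprK.
  have dE := @is_derive1_comp _ expR (fun s : R => - s^-1) _ _ _ (is_derive_expR (- t^-1)) dN.
  have := is_deriveM dX dE; rewrite /flat t0; congr (is_derive _ _ _ _).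
  have scaleE (x y : R) : x *: y = x * y by [].
  rewrite !scaleE /=.
  case: n {dX dE} => [|n]; rewrite /= ?mul0r ?mulr0 ?expr0 !exprVn !exprS.
    by field.
  field.
  by rewrite tn0 expf_neq0.
- apply: (@is_derive_near (cst 0)).
    have := lt_nbhsl t0.
    by apply: filterS => s s0; rewrite flat_le0// ltW.
  by rewrite !flat_le0 ?ltW// mulr0 subr0; exact: is_derive_cst.
rewrite !flat_le0// mulr0 subr0.
have g0 : (fun h => h^-1 *: ((flat n \o shift 0) (h *: 1) - flat n 0)) @ 0^' --> (0 : R).
  rewrite flat_le0//.
  apply/cvgrPdist_le => e e0; near=> h.
  rewrite sub0r normrN subr0 /= addr0 [h *: 1]mulr1.
  have -> : h^-1 *: flat n h = flat n.+1 h.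
    by rewrite /flat; case: ifPn => _; [rewrite exprS -mulrA|rewrite scaler0].
  apply: (le_trans (flat_bound _ _)).
  rewrite -ler_pdivlMl ?ltr0n ?fact_gt0//.
  near: h; apply: nbhs_dnbhs.
  have : 0 < n.+2`!%:R^-1 * e by rewrite mulr_gt0 ?invr_gt0 ?ltr0n ?fact_gt0.
  exact: (@nbhs0_le _ R^o).
by apply: DeriveDef; [apply/cvg_ex; exists 0|exact: cvg_lim g0].
Unshelve. all: by end_near. Qed.

Lemma continuous_flat n : continuous (flat n).
Proof.
move=> t; apply/differentiable_continuous/derivable1_diffP.
by have [] := is_derive_flat n t.
Qed.

End flat_function.

(** * Smooth cutoffs *)

Section cutoff.
Context {R : realType} {d : nat}.
Local Notation E := 'rV[R]_d.
Implicit Types (x y : E) (i j : 'I_d).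

Lemma derive_lineE (f : E -> R) x v :
  'D_v f x = 'D_1 (fun h : R => f (h *: v + x)) 0.
Proof.
rewrite /derive; set g1 := fun h => h^-1 *: _; set g2 := fun h => h^-1 *: _.
suff -> : g1 = g2 by [].
by rewrite funeqE /g1 /g2 => h /=; rewrite addr0 scale0r add0r [_%:A]mulr1.
Qed.

(** Along [delta_mx 0 j] the function is [flat n] of an affine function, and its
    partial derivative is again built from functions of this form. *)
Lemma Ck_flat_coord k n i (al be : R) :
  Ck k (fun x : E => flat n (al * x 0 i + be)).
Proof.
have cont m : continuous (fun x : E => flat m (al * x 0 i + be)).
  move=> x; apply: (@continuous_comp _ _ _ (fun x : E => al * x 0 i + be) (flat m)).
    apply: continuous_add; last exact: cst_continuous.
    by apply: continuous_mul; [exact: cst_continuous|exact: coord_continuous].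
  exact: continuous_flat.
elim: k n => [|k IH] n; first exact: cont.
split => // j.
have lineE x : (fun h : R => flat n (al * (h *: delta_mx 0 j + x) 0 i + be)) =
    flat n \o (fun h => al * (i == j)%:R * h + (al * x 0 i + be)).
  by apply/funext => h /=; rewrite !mxE/=; congr flat; ring.
have dline x : is_derive (0 : R) 1
    (fun h : R => flat n (al * (h *: delta_mx 0 j + x) 0 i + be))
    ((flat n.+2 (al * x 0 i + be) - n%:R * flat n.+1 (al * x 0 i + be)) *
      (al * (i == j)%:R)).
  rewrite lineE; apply: is_derive1_comp; first by rewrite mulr0 add0r; exact: is_derive_flat.
  have -> : (fun h : R => al * (i == j)%:R * h + (al * x 0 i + be)) =
     (al * (i == j)%:R) \*: id + cst (al * x 0 i + be).
    by apply/funext => h.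
  by apply: is_derive_eq; rewrite addr0 [LHS]mulr1.
split=> [x|].
  by apply/derivable1P; have [] := dline x.
rewrite (_ : partial_deriv j _ = fun x =>
   (flat n.+2 (al * x 0 i + be) + (- n%:R) * flat n.+1 (al * x 0 i + be)) *
      (al * (i == j)%:R)); last first.
  apply/funext => x; rewrite /partial_deriv derive_lineE.
  by have [_ ->] := dline x; rewrite mulNr.
apply: Ck_mul; last exact: Ck_cst.
by apply: Ck_add => //; apply: Ck_mul => //; exact: Ck_cst.
Qed.

(** The quotient [F y / (F y + F (1 - y))] with [F = flat 0] and
    [y = al * x 0 i + be] climbs from [0] to [1] as [y] goes from [0] to [1]. *)
Definition coord_step i (al be : R) x : R :=
  flat 0 (al * x 0 i + be) *
  (flat 0 (al * x 0 i + be) + flat 0 (- al * x 0 i + (1 - be)))^-1.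

Let step_denom_gt0 (y : R) : 0 < flat 0 y + flat 0 (1 - y).
Proof.
have [y0|y0] := ltP 0 y.
  by rewrite ltr_pwDl ?flat_gt0 ?flat_ge0.
by rewrite ltr_pwDr ?flat_ge0// flat_gt0// subr_gt0 (le_lt_trans y0).
Qed.

Let step_denomE i al be x : - al * x 0 i + (1 - be) = 1 - (al * x 0 i + be).
Proof. by ring. Qed.

Lemma Ck_coord_step k i al be : Ck k (coord_step i al be).
Proof.
apply: Ck_mul; first exact: Ck_flat_coord.
apply: Ck_inv; last by apply: Ck_add; exact: Ck_flat_coord.
by move=> x; rewrite step_denomE gt_eqF.
Qed.

Lemma coord_step_ge0 i al be x : 0 <= coord_step i al be x.
Proof.
by rewrite /coord_step step_denomE mulr_ge0 ?flat_ge0// invr_ge0 ltW.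
Qed.

Lemma coord_step_le1 i al be x : coord_step i al be x <= 1.
Proof.
by rewrite /coord_step step_denomE ler_pdivrMr// mul1r lerDl flat_ge0.
Qed.

Lemma coord_step0 i al be x : al * x 0 i + be <= 0 -> coord_step i al be x = 0.
Proof. by move=> y0; rewrite /coord_step flat_le0// mul0r. Qed.

Lemma coord_step1 i al be x : 1 <= al * x 0 i + be -> coord_step i al be x = 1.
Proof.
move=> y1; rewrite /coord_step step_denomE (@flat_le0 _ _ (1 - _)) ?subr_le0//.
by rewrite addr0 divff// gt_eqF// flat_gt0// (lt_le_trans ltr01).
Qed.

(** On each axis the two steps are [1] up to distance [r / 2] from [x0] and [0]
    from distance [3 r / 4] on. *)
Definition bump x0 (r : R) x : R := \prod_i
  (coord_step i (4 / r) (3 - 4 / r * x0 0 i) x *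
   coord_step i (- (4 / r)) (3 + 4 / r * x0 0 i) x).

Lemma Ck_bump k x0 r : Ck k (bump x0 r).
Proof. by apply: Ck_prod => i; apply: Ck_mul; exact: Ck_coord_step. Qed.

Lemma bump_ge0 x0 r x : 0 <= bump x0 r x.
Proof. by apply: prodr_ge0 => i _; rewrite mulr_ge0 ?coord_step_ge0. Qed.

Lemma bump_le1 x0 r x : bump x0 r x <= 1.
Proof.
apply: prodr_ile1 => i _; rewrite mulr_ge0 ?coord_step_ge0//=.
by rewrite mulr_ile1 ?coord_step_ge0 ?coord_step_le1.
Qed.

Lemma bump1 x0 r x : 0 < r -> ball x0 (r / 2) x -> bump x0 r x = 1.
Proof.
move=> r0 [_ xb]; apply: big1 => i _.
have := xb 0 i; rewrite /ball/= ltr_norml => /andP[xl xr].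
have r1 : 4 / r * (r / 2) = 2 by field; rewrite gt_eqF.
have r4 : 0 < 4 / r by rewrite divr_gt0.
have := xl; rewrite -(ltr_pM2l r4) mulrN r1 => xl'.
have := xr; rewrite -(ltr_pM2l r4) r1 => xr'.
by rewrite !coord_step1 ?mulr1//; lra.
Qed.

Definition bump_support x0 (r : R) : set E :=
  [set x | forall i, `[x0 0 i - r * (3 / 4), x0 0 i + r * (3 / 4)]%classic (x 0 i)].

Lemma compact_bump_support x0 r : compact (bump_support x0 r).
Proof.
exact: (@rV_compact _ _ (fun i => `[x0 0 i - r * (3 / 4), x0 0 i + r * (3 / 4)]%classic)
  (fun i => @segment_compact _ _ _)).
Qed.

Lemma bump_support_ball x0 r : 0 < r -> bump_support x0 r `<=` ball x0 r.
Proof.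
move=> r0 x xs; split=> // i j; rewrite (ord1 i); have := xs j.
rewrite /= in_itv/= => /andP[xl xr].
by rewrite /ball/= ltr_norml; lra.
Qed.

Lemma bump0 x0 r x : 0 < r -> ~ bump_support x0 r x -> bump x0 r x = 0.
Proof.
move=> r0 /existsNP[i]; rewrite /= in_itv/= => /negP.
have r1 : 4 / r * (r * (3 / 4)) = 3 by field; rewrite gt_eqF.
have r4 : 0 < 4 / r by rewrite divr_gt0.
rewrite negb_and -!ltNge => xs; rewrite /bump (bigD1 i)//=.
suff -> : coord_step i (4 / r) (3 - 4 / r * x0 0 i) x *
   coord_step i (- (4 / r)) (3 + 4 / r * x0 0 i) x = 0 by rewrite mul0r.
by case/orP: xs; rewrite -(ltr_pM2l r4) => ?;
  [rewrite coord_step0 ?mul0r//|rewrite [X in _ * X]coord_step0 ?mulr0//]; lra.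
Qed.

(** Finitely many of the sets where a bump supported in [U] equals [1] cover
    [K], and [1 - \prod (1 - bump)] equals [1] as soon as one of the bumps
    does. The cutoff is [1] on a neighbourhood of [K], not just on [K], so that
    [1 - eta] has its support away from [K]. *)
Lemma smooth_cutoff (K U : set E) : compact K -> open U -> K `<=` U ->
  exists eta : E -> R, [/\ forall k, Ck k eta,
    forall x, 0 <= eta x <= 1,
    exists2 W, open W /\ K `<=` W & forall x, W x -> eta x = 1 &
    exists2 C, compact C /\ C `<=` U & forall x, ~ C x -> eta x = 0].
Proof.
move=> cK oU KU.
have /choice[r rP] x : exists r : R, 0 < r /\ (K x -> ball x r `<=` U).
  have [Kx|nKx] := pselect (K x); last by exists 1.
  by have /nbhs_ballP[e /= e0 xe] := open_nbhs_nbhs (conj oU (KU _ Kx)); exists e.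
have r0 x : 0 < r x by have [] := rP x.
have : cover_compact K by rewrite -compact_cover.
move=> /(_ E K (fun x => ball x (r x / 2))).
case=> [x _|x Kx|D DK KD].
- exact: ball_open.
- by exists x => //; apply: ballxx; rewrite divr_gt0.
pose s : seq E := enum_fset D.
exists (fun x => 1 - \prod_(y <- s) (1 - bump y (r y) x)); split.
- move=> k; apply: Ck_add; first exact: Ck_cst.
  apply: Ck_opp; apply: Ck_prod => y; apply: Ck_add; first exact: Ck_cst.
  by apply: Ck_opp; exact: Ck_bump.
- move=> x; rewrite subr_ge0 gerBl.
  rewrite prodr_ge0 ?andbT.
    by apply: prodr_ile1 => y _; rewrite subr_ge0 gerBl bump_ge0 bump_le1.
  by move=> y _; rewrite subr_ge0 bump_le1.
- exists (\bigcup_(y in [set` D]) ball y (r y / 2)); first split => //.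
    by apply: bigcup_open => y _; exact: ball_open.
  move=> x [y /= yD xy].
  by rewrite (big_rem y)//= bump1// subrr mul0r subr0.
- exists (\big[setU/set0]_(y <- s) bump_support y (r y)); first split.
  + apply: bigsetU_compact => y _.
    exact: compact_bump_support.
  + rewrite -bigcup_seq => x [y /= ys] /(bump_support_ball (r0 y)).
    by have [_] := rP y; apply; exact/set_mem/DK.
  move=> x; rewrite -bigcup_seq => nx.
  rewrite big_seq big1 ?subrr// => y ys; rewrite bump0 ?subr0//.
  by apply: contra_not nx => ?; exists y.
Qed.

End cutoff.

(** * The Euclidean norm and compactly supported fields *)

Section euclidean_norm.
Context {R : realType} {d : nat}.
Local Notation E := 'rV[R]_d.
Implicit Types x y : E.

Lemma enorm_ge0 x : 0 <= enorm x.
Proof. exact: sqrtr_ge0. Qed.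

Lemma enorm0 : enorm (0 : E) = 0.
Proof.
by rewrite /enorm big1 ?sqrtr0// => i _; rewrite mxE expr0n.
Qed.

Lemma sqr_enorm x : enorm x ^+ 2 = \sum_i x 0 i ^+ 2.
Proof. by rewrite sqr_sqrtr// sumr_ge0// => i _; exact: sqr_ge0. Qed.

Lemma enormZ (c : R) x : enorm (c *: x) = `|c| * enorm x.
Proof.
rewrite /enorm -sqrtr_sqr -sqrtrM ?sqr_ge0// mulr_sumr.
by congr (Num.sqrt _); apply: eq_bigr => i _; rewrite mxE exprMn.
Qed.

Lemma coord_le_enorm x i : `|x 0 i| <= enorm x.
Proof.
rewrite -sqrtr_sqr /enorm ler_sqrt; last first.
  by rewrite sumr_ge0// => j _; exact: sqr_ge0.
by rewrite (bigD1 i)//= lerDl sumr_ge0// => j _; exact: sqr_ge0.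
Qed.

Lemma enorm_delta (i : 'I_d) : enorm (delta_mx 0 i : E) = 1.
Proof.
rewrite /enorm (bigD1 i)//= big1 ?addr0; last first.
  by move=> j /negbTE ji; rewrite mxE ji andbF expr0n.
by rewrite mxE !eqxx expr1n sqrtr1.
Qed.

Lemma enorm_eq0 x : enorm x = 0 -> x = 0.
Proof.
move=> x0; apply/rowP => i; rewrite mxE; apply/eqP.
by have := coord_le_enorm x i; rewrite x0 normr_le0.
Qed.

Lemma enorm_gt0 x : x != 0 -> 0 < enorm x.
Proof.
move=> x0; rewrite lt_neqAle enorm_ge0 andbT eq_sym.
by apply: contra_neq x0; exact: enorm_eq0.
Qed.

(** Sum of the inequalities [2 x_i y_i <= (b / a) x_i^2 + (a / b) y_i^2], where
    [a] and [b] are the two norms. *)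
Lemma dot_le_enorm x y : \sum_i x 0 i * y 0 i <= enorm x * enorm y.
Proof.
have [->|/enorm_gt0 a0] := eqVneq x 0.
  by rewrite enorm0 mul0r big1// => i _; rewrite mxE mul0r.
have [->|/enorm_gt0 b0] := eqVneq y 0.
  by rewrite enorm0 mulr0 big1// => i _; rewrite mxE mulr0.
set a := enorm x in a0 *; set b := enorm y in b0 *.
apply: (@le_trans _ _ (\sum_i (b / a / 2 * x 0 i ^+ 2 + a / b / 2 * y 0 i ^+ 2))).
  apply: ler_sum => i _; rewrite -subr_ge0.
  rewrite [leRHS](_ : _ = (b * x 0 i - a * y 0 i) ^+ 2 / (2 * a * b)); last first.
    by field; rewrite !gt_eqF.
  by rewrite divr_ge0 ?sqr_ge0// !mulr_ge0// ltW.
rewrite big_split/= -!mulr_sumr -!sqr_enorm -/a -/b le_eqVlt; apply/orP; left.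
by apply/eqP; field; rewrite !gt_eqF.
Qed.

Lemma ler_enormD x y : enorm (x + y) <= enorm x + enorm y.
Proof.
rewrite -(@ler_pXn2r _ 2)// ?nnegrE ?addr_ge0 ?enorm_ge0//.
rewrite sqrrD !sqr_enorm.
rewrite [leLHS](_ : _ = \sum_i x 0 i ^+ 2 + (\sum_i x 0 i * y 0 i) *+ 2 +
    \sum_i y 0 i ^+ 2); last first.
  rewrite -sumrMnl -!big_split /=; apply: eq_bigr => i _.
  by rewrite mxE sqrrD.
by rewrite lerD2r lerD2l lerMn2r dot_le_enorm orbT.
Qed.

Lemma ler_enorm_sum (I : Type) (s : seq I) (F : I -> E) :
  enorm (\sum_(i <- s) F i) <= \sum_(i <- s) enorm (F i).
Proof.
elim: s => [|i s IH]; first by rewrite !big_nil enorm0.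
by rewrite !big_cons (le_trans (ler_enormD _ _))// lerD2l.
Qed.

Lemma continuous_enorm (T : topologicalType) (phi : T -> E) :
  (forall i, continuous (fun t : T => phi t 0 i)) -> continuous (enorm \o phi).
Proof.
move=> cphi t; apply: (@continuous_comp _ _ _ (fun t : T => \sum_i phi t 0 i ^+ 2)
  Num.sqrt); last exact: sqrt_continuous.
by apply: continuous_sum => i; exact: continuous_mul.
Qed.

End euclidean_norm.

Section test_fields.
Context {R : realType} {d : nat}.
Local Notation E := 'rV[R]_d.
Implicit Types (U W K : set E) (phi psi : E -> E) (eta : E -> R).

(** Any compact set containing the points where [phi] is nonzero may replace the
    closed support. *)
Lemma CkcP k U phi : Ckc k U phi <->
  (forall i, Ck k (fun x => phi x 0 i)) /\
  (exists2 C, compact C /\ C `<=` U & forall x, ~ C x -> phi x = 0).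
Proof.
split=> [[Cphi cS SU]|[Cphi [C [cC CU] C0]]].
  split=> //; exists (closure [set x | phi x != 0]) => // x nx.
  by apply/eqP; apply: contra_notT nx => px; exact: subset_closure.
have SC : closure [set x | phi x != 0] `<=` C.
  have clC := compact_closed_rV cC.
  rewrite [X in _ `<=` X]((closure_id C).1 clC); apply: closure_subset => x /=.
  by move=> px; apply: contrapT => /C0 p0; rewrite p0 eqxx in px.
split=> //; last exact: subset_trans CU.
by apply: (subclosed_compact _ cC SC); exact: closed_closure.
Qed.

Lemma Ckc_subset k U W phi : U `<=` W -> Ckc k U phi -> Ckc k W phi.
Proof. by move=> UW [? ? h]; split => //; exact: subset_trans UW. Qed.

Lemma Ckc0 k U : Ckc k U (fun=> 0).
Proof.
apply/CkcP; split => [i|]; first by under eq_fun do rewrite mxE; exact: Ck_cst.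
by exists set0 => //; split => //; exact: compact0.
Qed.

Lemma Ckc_add k U phi psi :
  Ckc k U phi -> Ckc k U psi -> Ckc k U (fun x => phi x + psi x).
Proof.
move=> /CkcP[Cphi [C [cC CU] C0]] /CkcP[Cpsi [D [cD DU] D0]]; apply/CkcP; split.
  by move=> i; under eq_fun do rewrite mxE; exact: Ck_add.
exists (C `|` D); first by split; [exact: compactU|rewrite subUset].
by move=> x /not_orP[/C0 -> /D0 ->]; rewrite addr0.
Qed.

Lemma Ckc_mul k U eta phi :
  Ck k eta -> Ckc k U phi -> Ckc k U (fun x => eta x *: phi x).
Proof.
move=> Ceta /CkcP[Cphi [C CU C0]]; apply/CkcP; split.
  by move=> i; under eq_fun do rewrite mxE; exact: Ck_mul.
by exists C => // x /C0 ->; rewrite scaler0.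
Qed.

Lemma Ckc_scale k U (c : R) phi : Ckc k U phi -> Ckc k U (fun x => c *: phi x).
Proof. exact/Ckc_mul/Ck_cst. Qed.

Lemma Ckc_sum k U (I : Type) (s : seq I) (F : I -> E -> E) :
  (forall i, Ckc k U (F i)) -> Ckc k U (fun x => \sum_(i <- s) F i x).
Proof.
move=> CF; elim: s => [|i s IH].
  by under eq_fun do rewrite big_nil; exact: Ckc0.
by under eq_fun do rewrite big_cons; exact: Ckc_add.
Qed.

Lemma Ckc_enorm_bounded k U phi : Ckc k U phi ->
  exists2 M : R, 0 <= M & forall x, enorm (phi x) <= M.
Proof.
move=> /CkcP[Cphi [C [cC _] C0]].
have [C_|/set0P/negP] := pselect (C !=set0); last first.
  rewrite negbK => /eqP Ce; exists 0 => // x.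
  by rewrite C0 ?enorm0// Ce.
have cphi : continuous (enorm \o phi).
  by apply: continuous_enorm => i; exact: Ck_continuous (Cphi i).
have [c _ cmax] := compact_EVT_max C_ cC (continuous_subspaceT cphi).
exists (enorm (phi c)); first exact: enorm_ge0.
move=> x; have [Cx|nCx] := pselect (C x); first by apply: cmax; exact/mem_set.
by rewrite C0// enorm0 enorm_ge0.
Qed.

(** With [C] the support and [eta] a cutoff equal to [1] near the compact
    [C `\` W], the fields are [eta phi] and [(1 - eta) phi]. This replaces
    partitions of unity throughout. *)
Lemma Ckc_split k U W phi : open U -> open W -> Ckc k (U `|` W) phi ->
  exists phi1 phi2, [/\ Ckc k U phi1, Ckc k W phi2,
    forall x, phi x = phi1 x + phi2 x,
    forall x, enorm (phi1 x) <= enorm (phi x) &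
    forall x, enorm (phi2 x) <= enorm (phi x)].
Proof.
move=> oU oW /CkcP[Cphi [C [cC CUW] C0]].
have cCW : compact (C `\` W) by exact: compactD_open.
have CWU : C `\` W `<=` U by move=> x [/CUW[]].
have [eta [Ceta eta01 [V [oV CV] V1] [D [cD DU] D0]]] :=
  smooth_cutoff cCW oU CWU.
have Ceta' : Ck k (fun x => 1 - eta x).
  by apply: Ck_add; [exact: Ck_cst|exact: Ck_opp].
exists (fun x => eta x *: phi x), (fun x => (1 - eta x) *: phi x); split.
- apply/CkcP; split; first by move=> i; under eq_fun do rewrite mxE; exact: Ck_mul.
  by exists D => // x /D0 ->; rewrite scale0r.
- apply/CkcP; split; first by move=> i; under eq_fun do rewrite mxE; exact: Ck_mul.
  exists (C `\` V); first split.
  + exact: compactD_open.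
  + by move=> x [Cx nVx]; apply: contrapT => nWx; exact/nVx/CV.
  + move=> x /not_andP[/C0 ->|/contrapT/V1 ->]; first by rewrite scaler0.
    by rewrite subrr scale0r.
- by move=> x; rewrite -scalerDl addrC subrK scale1r.
- move=> x; have /andP[e0 e1] := eta01 x.
  by rewrite enormZ ger0_norm// ler_piMl// enorm_ge0.
- move=> x; have /andP[e0 e1] := eta01 x.
  by rewrite enormZ ger0_norm ?subr_ge0// ler_piMl// ?enorm_ge0// gerBl.
Qed.

End test_fields.

(** * The mass of a bounded functional on fields *)

Section total_variation_measure.
Context {R : realType} {d : nat}.
Local Notation E := 'rV[R]_d.
Variables (Om : set E) (L : (E -> E) -> R) (V : R).
Hypothesis oOm : open Om.
Hypothesis LD : forall phi psi, Ckc 1 Om phi -> Ckc 1 Om psi ->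
  L (fun x => phi x + psi x) = L phi + L psi.
Hypothesis LZ : forall c phi, Ckc 1 Om phi ->
  L (fun x => c *: phi x) = c * L phi.
Hypothesis LV : forall phi, Ckc 1 Om phi -> (forall x, enorm (phi x) <= 1) ->
  L phi <= V.
Implicit Types (U W A K : set E) (phi psi : E -> E) (eta : E -> R).

Lemma functional0 : L (fun=> 0) = 0.
Proof.
have := LZ 0 (Ckc0 1 Om); rewrite mul0r => <-; congr L.
by apply/funext => x; rewrite scaler0.
Qed.

Lemma functional_sum (I : Type) (s : seq I) (F : I -> E -> E) :
  (forall i, Ckc 1 Om (F i)) ->
  L (fun x => \sum_(i <- s) F i x) = \sum_(i <- s) L (F i).
Proof.
move=> CF; elim: s => [|i s IH].
  by under eq_fun do rewrite big_nil; rewrite functional0 big_nil.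
under eq_fun do rewrite big_cons.
by rewrite LD ?IH ?big_cons//; exact: Ckc_sum.
Qed.

Local Open Scope ereal_scope.

Definition test_unit U : set (E -> E) :=
  [set phi | Ckc 1 (U `&` Om) phi /\ forall x, (enorm (phi x) <= 1)%R].

Definition open_mass U : \bar R := ereal_sup [set (L phi)%:E | phi in test_unit U].

Lemma test_unitW U phi : test_unit U phi -> Ckc 1 Om phi.
Proof. by move=> [Cphi _]; apply: Ckc_subset Cphi; exact: subIsetr. Qed.

Lemma open_mass_ge0 U : 0 <= open_mass U.
Proof.
apply: ereal_sup_ubound; exists (fun=> 0)%R; last by rewrite functional0.
by split=> [|x]; [exact: Ckc0|rewrite enorm0].
Qed.

Lemma open_mass_le U : open_mass U <= V%:E.
Proof.
apply: ge_ereal_sup => _ [phi Tphi <-]; rewrite lee_fin.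
by apply: LV; [exact: test_unitW Tphi|case: Tphi].
Qed.

Lemma open_mass_fin U : open_mass U \is a fin_num.
Proof.
by rewrite ge0_fin_numE ?open_mass_ge0// (le_lt_trans (open_mass_le U))// ltry.
Qed.

Lemma functional_bound_ge0 : (0 <= V)%R.
Proof.
by rewrite -lee_fin (le_trans (open_mass_ge0 setT))// open_mass_le.
Qed.

Lemma le_open_mass U W : U `<=` W -> open_mass U <= open_mass W.
Proof.
move=> UW; apply: le_ereal_sup => _ [phi [Cphi phi1] <-]; exists phi => //.
by split=> //; apply: Ckc_subset Cphi; exact: setSI.
Qed.

Lemma functional_le_open_mass U phi c : (0 <= c)%R -> Ckc 1 (U `&` Om) phi ->
  (forall x, enorm (phi x) <= c)%R -> (L phi <= c * fine (open_mass U))%R.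
Proof.
move=> c0 Cphi phic.
have COm : Ckc 1 Om phi by apply: Ckc_subset Cphi; exact: subIsetr.
have [c_eq0|c_neq0] := eqVneq c 0%R.
  rewrite c_eq0 mul0r [phi](_ : _ = fun=> 0)%R ?functional0//.
  apply/funext => x; apply/enorm_eq0/eqP.
  by rewrite eq_le enorm_ge0 andbT -c_eq0.
have c_gt0 : (0 < c)%R by rewrite lt_neqAle eq_sym c_neq0.
rewrite -ler_pdivrMl// -LZ// -lee_fin fineK ?open_mass_fin//.
apply: ereal_sup_ubound; exists (fun x => c^-1 *: phi x)%R => //.
split=> [|x]; first exact: Ckc_scale.
by rewrite enormZ gtr0_norm ?invr_gt0// ler_pdivrMl// mulr1.
Qed.

(** The field is split along the cover of its support by [U] and by the open set
    where its norm is less than [dl]; each part keeps the pointwise bounds of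
    the field. *)
Lemma functional_le_off U phi c dl : open U -> (0 <= c)%R -> (0 < dl)%R ->
  Ckc 1 Om phi -> (forall x, enorm (phi x) <= c)%R ->
  (forall x, Om x -> ~ U x -> enorm (phi x) < dl)%R ->
  (L phi <= c * fine (open_mass U) + dl * V)%R.
Proof.
move=> oU c0 dl0 Cphi phic phidl.
pose W := [set x | (enorm (phi x) < dl)%R].
have oW : open W.
  have cphi : continuous (enorm \o phi).
    by apply: continuous_enorm => i; have [/(_ i)/Ck_continuous] := Cphi.
  by have := (continuousP _).1 cphi _ (@open_lt _ dl).
have : Ckc 1 ((U `&` Om) `|` (W `&` Om)) phi.
  apply: Ckc_subset Cphi => x Omx; rewrite -setIUl; split => //.
  by have [|nU] := pselect (U x); [left|right; exact: phidl].
move=> /Ckc_split[||phi1 [phi2 [C1 C2 phiE le1 le2]]]; try exact: openI.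
have [c' [c'0 phi2c' c'dl]] : exists c', [/\ (0 <= c')%R,
    (forall x, enorm (phi2 x) <= c')%R & (c' <= dl)%R].
  exists dl; split => // [|x]; first exact: ltW.
  have [Wx|nWx] := pselect ((W `&` Om) x).
    by rewrite (le_trans (le2 x))// ltW//; case: Wx.
  have /CkcP[_ [D [_ DW] D0]] := C2.
  by rewrite D0 ?enorm0 ?ltW//; apply: contra_not nWx => /DW.
rewrite (_ : phi = fun x => phi1 x + phi2 x)%R; last exact/funext.
rewrite LD; last 2 first.
- by apply: Ckc_subset C1; exact: subIsetr.
- by apply: Ckc_subset C2; exact: subIsetr.
apply: lerD.
  by apply: functional_le_open_mass => // x; exact: le_trans (phic x).
apply: (le_trans (functional_le_open_mass c'0 C2 phi2c')).
rewrite ler_pM//; first by rewrite fine_ge0// open_mass_ge0.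
by rewrite -lee_fin fineK ?open_mass_fin// open_mass_le.
Qed.

Lemma open_massU U W : open U -> open W ->
  open_mass (U `|` W) <= open_mass U + open_mass W.
Proof.
move=> oU oW; apply: ge_ereal_sup => _ [phi [Cphi phi1] <-].
move: Cphi; rewrite setIUl => /Ckc_split[||p1 [p2 [C1 C2 phiE le1 le2]]];
  try exact: openI.
rewrite (_ : phi = fun x => p1 x + p2 x)%R; last exact/funext.
rewrite LD; last 2 first.
- by apply: Ckc_subset C1; exact: subIsetr.
- by apply: Ckc_subset C2; exact: subIsetr.
rewrite EFinD; apply: leeD; apply: ereal_sup_ubound.
  by exists p1 => //; split=> // x; exact: le_trans (phi1 x).
by exists p2 => //; split=> // x; exact: le_trans (phi1 x).
Qed.

Lemma open_mass0 : open_mass set0 = 0.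
Proof.
apply/eqP; rewrite eq_le open_mass_ge0 andbT.
apply: ge_ereal_sup => _ [phi [Cphi phi1] <-].
rewrite [phi](_ : _ = fun=> 0)%R ?functional0//.
apply/funext => x; have /CkcP[_ [D [_ DW] D0]] := Cphi.
by apply: D0 => /DW[].
Qed.

Lemma open_mass_bigsetU (I : Type) (s : seq I) (F : I -> set E) :
  (forall k, open (F k)) ->
  open_mass (\big[setU/set0]_(k <- s) F k) <= \sum_(k <- s) open_mass (F k).
Proof.
move=> oF; elim: s => [|k s IH]; first by rewrite !big_nil open_mass0.
have oB : open (\big[setU/set0]_(j <- s) F j).
  by elim/big_ind : _ => [|? ?|k' _]; [exact: open0|exact: openU|].
rewrite !big_cons/=; apply: (le_trans (open_massU (oF k) oB)).
exact: leeD.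
Qed.

(** The support of a test field is compact, so it is covered by finitely many of
    the open sets, and finite subadditivity applies. *)
Lemma open_mass_bigcup (F : nat -> set E) : (forall k, open (F k)) ->
  open_mass (\bigcup_k F k) <= \sum_(k <oo) open_mass (F k).
Proof.
move=> oF; apply: ge_ereal_sup => _ [phi [/CkcP[Cphi [C [cC CF] C0]] phi1] <-].
have : cover_compact C by rewrite -compact_cover.
case/(_ nat setT F) => [k _|x /CF[]//|D _ CD]; first exact: oF.
pose n := (\max_(k <- enum_fset D) k).+1.
have Cn : C `<=` \big[setU/set0]_(k < n) F k.
  move=> x /[dup] Cx /CD[k /= kD Fk]; rewrite -bigcup_mkord; exists k => //=.
  by rewrite ltnS; exact: (@leq_bigmax_seq _ _ predT id).
apply: (@le_trans _ _ (open_mass (\big[setU/set0]_(k < n) F k))).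
  apply: ereal_sup_ubound; exists phi => //; split=> //; apply/CkcP; split=> //.
  by exists C => //; split=> // x Cx; split; [exact: Cn|by have [] := CF _ Cx].
apply: (@le_trans _ _ (\sum_(k < n) open_mass (F k))).
  by apply: open_mass_bigsetU => k; exact: oF.
rewrite -(big_mkord xpredT (open_mass \o F)).
by apply: nneseries_lim_ge => k _ _; exact: open_mass_ge0.
Qed.

Definition outer_mass A : \bar R :=
  ereal_inf [set open_mass U | U in [set U | open U /\ A `<=` U]].

Lemma outer_mass_open U : open U -> outer_mass U = open_mass U.
Proof.
move=> oU; apply/eqP; rewrite eq_le; apply/andP; split.
  by apply: ereal_inf_lbound; exists U => //; split.
by apply: le_ereal_inf_tmp => _ [W [oW UW] <-]; exact: le_open_mass.
Qed.

Lemma outer_mass_ge0 A : 0 <= outer_mass A.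
Proof. by apply: le_ereal_inf_tmp => _ [W _ <-]; exact: open_mass_ge0. Qed.

Lemma outer_mass_le A : outer_mass A <= V%:E.
Proof.
apply: (@le_trans _ _ (open_mass setT)); last exact: open_mass_le.
by apply: ereal_inf_lbound; exists setT => //; split => //; exact: openT.
Qed.

Lemma outer_mass_fin A : outer_mass A \is a fin_num.
Proof.
by rewrite ge0_fin_numE ?outer_mass_ge0// (le_lt_trans (outer_mass_le A))// ltry.
Qed.

Lemma outer_mass_adherent A (e : R) : (0 < e)%R ->
  exists U, [/\ open U, A `<=` U & open_mass U <= outer_mass A + e%:E].
Proof.
move=> e0; have [_ [U [oU AU] <-] /ltW lt] :=
  lb_ereal_inf_adherent e0 (outer_mass_fin A).
by exists U.
Qed.

Lemma le_outer_mass : {homo outer_mass : A B / A `<=` B >-> A <= B}.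
Proof.
move=> A B AB; apply: le_ereal_inf => _ [U [oU BU] <-]; exists U => //.
by split=> //; exact: subset_trans BU.
Qed.

Lemma outer_mass0 : outer_mass set0 = 0.
Proof. by rewrite outer_mass_open ?open_mass0//; exact: open0. Qed.

Lemma outer_mass_sigma_subadditive : sigma_subadditive outer_mass.
Proof.
move=> A; apply/lee_addgt0Pr => e e0.
rewrite (le_trans _ (epsilon_trick _ _ (ltW e0)))//; last first.
  by move=> n; exact: outer_mass_ge0.
have /choice[U UP] n : exists U, [/\ open U, A n `<=` U &
    open_mass U <= outer_mass (A n) + (e / (2 ^ n.+1)%:R)%:E].
  by apply: outer_mass_adherent; rewrite divr_gt0.
have oU n : open (U n) by have [] := UP n.
apply: (@le_trans _ _ (open_mass (\bigcup_n U n))).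
  apply: ereal_inf_lbound; exists (\bigcup_n U n) => //; split.
    by apply: bigcup_open => k _; exact: oU.
  by apply: subset_bigcup => n _; have [] := UP n.
apply: (le_trans (open_mass_bigcup oU)).
apply: lee_nneseries => [n _ _|n _]; first exact: open_mass_ge0.
by have [] := UP n.
Qed.

HB.instance Definition _ := isOuterMeasure.Build R E outer_mass
  outer_mass0 outer_mass_ge0 le_outer_mass outer_mass_sigma_subadditive.

(** Let [W] be open and contain the test set. Given a near-optimal field in
    [W `&` U], whose support is a compact [C], any field supported in [W `\` C]
    can be added to it without violating the pointwise bound, and [W `\` C] is
    an open set containing [W `\` U]. *)
Lemma open_caratheodory U : open U -> outer_mass.-caratheodory U.
Proof.
move=> oU; apply: le_caratheodory_measurable => A.
apply: le_ereal_inf_tmp => _ [W [oW AW] <-].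
apply: (@le_trans _ _ (open_mass (W `&` U) + outer_mass (W `\` U))).
  apply: leeD; last by apply: le_outer_mass; exact: setSD.
  by rewrite -outer_mass_open; [apply: le_outer_mass; exact: setSI|exact: openI].
have fW := outer_mass_fin (W `\` U).
rewrite -leeBrDr//; apply: ge_ereal_sup => _ [phi [Cphi phi1] <-].
rewrite leeBrDr// -leeBrDl//.
have /CkcP[_ [C [cC CWU] C0]] := Cphi.
have oWC : open (W `\` C) by exact: openD_compact.
apply: (@le_trans _ _ (open_mass (W `\` C))).
  rewrite -outer_mass_open//; apply: le_outer_mass => x [Wx nUx].
  by split=> // /CWU[[]].
apply: ge_ereal_sup => _ [psi [Cpsi psi1] <-].
rewrite leeBrDl// -EFinD -LD; last 2 first.
- by apply: Ckc_subset Cphi; exact: subIsetr.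
- by apply: Ckc_subset Cpsi; exact: subIsetr.
apply: ereal_sup_ubound; exists (fun x => phi x + psi x)%R => //; split.
  apply: Ckc_add; first by apply: Ckc_subset Cphi; rewrite -setIA; exact: setIS.
  by apply: Ckc_subset Cpsi; apply: setSI; exact: subDsetl.
move=> x; have [Cx|/C0 ->] := pselect (C x); last by rewrite add0r.
have /CkcP[_ [D [_ DW] D0]] := Cpsi.
by rewrite D0 ?addr0// => /DW[[]].
Qed.

(** Caratheodory's theorem gives a measure on a sigma-algebra that depends on
    [outer_mass]; it is transported to the Borel sets, which it contains. *)
Lemma exists_mass_measure :
  exists nu : {measure set E -> \bar R}, forall A, nu A = outer_mass A.
Proof.
have Borel_cara A : measurable A -> outer_mass.-caratheodory A.
  apply: (@smallest_sub _ _ (@open E) (outer_mass.-cara.-measurable)).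
    by apply: sigma_algebra_measurable.
  by move=> U oU; exact: open_caratheodory.
have sa : semi_sigma_additive (outer_mass : set E -> \bar R).
  move=> F mF tF mUF.
  have := @caratheodory_measure_sigma_additive R E outer_mass F.
  apply=> // [i|]; apply: Borel_cara => //.
pose nu : {measure set E -> \bar R} := HB.pack outer_mass
  (isMeasure.Build _ E R outer_mass outer_mass0 outer_mass_ge0 sa).
by exists nu.
Qed.

Let nu : {measure set E -> \bar R} := sval (cid exists_mass_measure).

Let nuE A : nu A = outer_mass A.
Proof. exact: (svalP (cid exists_mass_measure)). Qed.

Let nu_open U : open U -> nu U = open_mass U.
Proof. by move=> oU; rewrite nuE outer_mass_open. Qed.

Let nu_fin A : nu A \is a fin_num.
Proof. by rewrite nuE; exact: outer_mass_fin. Qed.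

Let nuD A B : measurable A -> measurable B -> B `<=` A ->
  nu (A `\` B) = nu A - nu B.
Proof.
move=> mA mB BA; have := measureD mA mB; rewrite (setIidr BA); apply.
by rewrite -ge0_fin_numE// nu_fin.
Qed.

Let nu_outer_regular A (e : R) : measurable A -> (0 < e)%R ->
  exists U, [/\ open U, A `<=` U & nu (U `\` A) <= e%:E].
Proof.
move=> mA e0; have [U [oU AU]] := outer_mass_adherent A e0.
rewrite -nu_open// -nuE => le; exists U; split => //.
by rewrite nuD// ?leeBlDl//; exact: open_measurable_mx.
Qed.

(** The support of a near-optimal field carries almost all the mass, because
    that field is a competitor in every open set containing its support. *)
Let nu_tight (e : R) : (0 < e)%R ->
  exists K, [/\ compact K, K `<=` Om & nu (Om `\` K) <= e%:E].
Proof.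
move=> e0; have [_ [phi [Cphi phi1] <-] /ltW lt] :=
  ub_ereal_sup_adherent e0 (open_mass_fin Om).
have /CkcP[CKphi [K [cK KOm] K0]] := Cphi.
exists K; split => //; first by move=> x /KOm[].
have mK := measurable_compact cK.
have LK : (L phi)%:E <= nu K.
  rewrite nuE; apply: le_ereal_inf_tmp => _ [W [oW KW] <-].
  apply: ereal_sup_ubound; exists phi => //; split => //.
  apply/CkcP; split => //; exists K => //; split => // x Kx.
  by split; [exact: KW|have [] := KOm _ Kx].
have mOm := open_measurable_mx oOm.
rewrite nuD//; last by move=> x /KOm[].
rewrite leeBlDr// addeC -leeBlDr// nu_open//.
exact: le_trans LK.
Qed.

(** The compact is obtained by removing, from a compact carrying almost all the
    mass, an open neighbourhood [W] of [Om `\` A] of almost the same mass. *)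
Lemma mass_regular A (e : R) : measurable A -> (0 < e)%R ->
  exists K U, [/\ compact K /\ open U, K `<=` A `&` Om, A `&` Om `<=` U, U `<=` Om &
    open_mass (U `\` K) <= e%:E].
Proof.
move=> mA e0; have e3 : (0 < e / 3)%R by rewrite divr_gt0.
have mOm := open_measurable_mx oOm.
have mAO : measurable (A `&` Om) by exact: measurableI.
have mOA : measurable (Om `\` A) by exact: measurableD.
have [U [oU AU leU]] := nu_outer_regular mAO e3.
have [W [oW OW leW]] := nu_outer_regular mOA e3.
have [C [cC COm leC]] := nu_tight e3.
have cK : compact (C `\` W) by exact: compactD_open.
exists (C `\` W), (U `&` Om); split => //.
- by split=> //; exact: openI.
- move=> x [Cx nWx]; split; last exact: COm.
  by apply: contrapT => nAx; apply/nWx/OW; split => //; exact: COm.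
- by rewrite subsetI.
rewrite -nu_open; last by apply: openD_compact => //; exact: openI.
have mC := measurable_compact cC; have mK := measurable_compact cK.
have mU := open_measurable_mx oU; have mW := open_measurable_mx oW.
have mUA : measurable (U `\` (A `&` Om)) by exact: measurableD.
have mWA : measurable (W `\` (Om `\` A)) by exact: measurableD.
have mOC : measurable (Om `\` C) by exact: measurableD.
have mWO : measurable ((W `\` (Om `\` A)) `|` (Om `\` C)) by exact: measurableU.
apply: (@le_trans _ _ (nu ((U `\` (A `&` Om)) `|`
    ((W `\` (Om `\` A)) `|` (Om `\` C))))).
  apply: le_measure; rewrite ?inE.
  - by apply: measurableD => //; exact: measurableI.
  - exact: measurableU.
  move=> x [[Ux Omx] nCW].
  have [Ax|nAx] := pselect (A x); last by left; split => // -[].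
  right; have [Cx|nCx] := pselect (C x); last by right.
  left; split; last by case.
  by apply: contrapT => nWx; apply: nCW.
apply: (le_trans (measureU2 _ mUA mWO)).
have -> : e%:E = (e / 3)%:E + ((e / 3)%:E + (e / 3)%:E).
  by rewrite -!EFinD; congr (_%:E); field.
apply: leeD => //; apply: (le_trans (measureU2 _ mWA mOC)).
exact: leeD.
Qed.

(** * Construction of the representing charges *)

Definition mass U : R := fine (open_mass U).

Let massE U : (mass U)%:E = open_mass U.
Proof. by rewrite fineK// open_mass_fin. Qed.

Local Open Scope ring_scope.

Let functional_le_offW U phi c dl : open U -> 0 <= c -> 0 <= dl ->
  Ckc 1 Om phi -> (forall x, enorm (phi x) <= c) ->
  (forall x, Om x -> ~ U x -> enorm (phi x) <= dl) ->
  L phi <= c * mass U + dl * V.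
Proof.
move=> oU c0 dl0 Cphi phic phidl.
apply: (ler_vanishing functional_bound_ge0) => e e0.
rewrite -addrA -mulrDl; apply: functional_le_off => // [|x Ox nUx].
  by rewrite ltr_wpDl.
by rewrite (le_lt_trans (phidl _ Ox nUx))// ltrDl.
Qed.

(** The set approximated is the trace [A `&` Om], so that the charges built from
    cutoffs are carried by [Om]. *)
Record cutoff A K U (eta : E -> R) : Prop := Cutoff {
  cutoff_compact : compact K ;
  cutoff_sub : K `<=` A `&` Om ;
  cutoff_open : open U ;
  cutoff_sup : A `&` Om `<=` U ;
  cutoff_Om : U `<=` Om ;
  cutoff_Ck : Ck 1 eta ;
  cutoff01 : forall x, 0 <= eta x <= 1 ;
  cutoff1 : forall x, K x -> eta x = 1 ;
  cutoff_support : exists2 C, compact C /\ C `<=` U & forall x, ~ C x -> eta x = 0 }.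

Let cutoff0 A K U eta x : cutoff A K U eta -> ~ U x -> eta x = 0.
Proof.
by move=> cut nUx; have [C [_ CU]] := cutoff_support cut; apply=> /CU.
Qed.

(** The mass of [U `\` K] therefore controls all that distinguishes the cutoff
    from the indicator. *)
Let cutoff_indic A K U eta x : cutoff A K U eta -> Om x -> ~ (U `\` K) x ->
  eta x = \1_A x.
Proof.
move=> cut Omx nUK; rewrite indicE.
have [Kx|nKx] := pselect (K x).
  rewrite (cutoff1 cut Kx) mem_set//.
  by have [] := cutoff_sub cut Kx.
have nUx : ~ U x by apply: contra_not nUK.
rewrite (cutoff0 cut nUx) memNset// => Ax.
by apply: nUx; exact: (cutoff_sup cut).
Qed.

Let cutoff_diff_open A K U eta : cutoff A K U eta -> open (U `\` K).
Proof.
by move=> cut; apply: openD_compact; [exact: cutoff_open cut|exact: cutoff_compact cut].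
Qed.

Let cutoff_field A K U eta (c : E) : cutoff A K U eta ->
  Ckc 1 U (fun x => eta x *: c).
Proof.
move=> cut; have [C CU C0] := cutoff_support cut.
apply/CkcP; split.
  move=> i; under eq_fun do rewrite mxE.
  by apply: Ck_mul; [exact: cutoff_Ck cut|exact: Ck_cst].
by exists C => // x /C0 ->; rewrite scale0r.
Qed.

Let cutoff_fieldW A K U eta (c : E) : cutoff A K U eta ->
  Ckc 1 Om (fun x => eta x *: c).
Proof.
move=> cut; apply: Ckc_subset (cutoff_field c cut); exact: cutoff_Om cut.
Qed.

Lemma exists_cutoff A (e : R) : measurable A -> 0 < e ->
  exists K U eta, cutoff A K U eta /\ mass (U `\` K) <= e.
Proof.
move=> mA e0; have [K [U [[cK oU] KA AU UOm le]]] := mass_regular mA e0.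
have KU : K `<=` U by exact: subset_trans AU.
have [eta [Ceta eta01 [W [oW KW] W1] supp]] := smooth_cutoff cK oU KU.
exists K, U, eta; split; last by rewrite -lee_fin massE.
by split=> // x /KW/W1.
Qed.

Definition coord_functional (i : 'I_d) (eta : E -> R) : R :=
  L (fun x => eta x *: delta_mx 0 i).

Let functional_cutoff A K U eta (c : E) : cutoff A K U eta ->
  L (fun x => eta x *: c) = \sum_i c 0 i * coord_functional i eta.
Proof.
move=> cut.
rewrite (_ : (fun _ => _) = fun x => \sum_i (c 0 i *: (eta x *: delta_mx 0 i))).
  rewrite functional_sum; last by move=> i; exact/Ckc_scale/cutoff_fieldW/cut.
  by apply: eq_bigr => i _; rewrite LZ//; exact: cutoff_fieldW cut.
apply/funext => x; rewrite [in LHS](row_sum_delta c) scaler_sumr.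
by apply: eq_bigr => i _; rewrite !scalerA mulrC.
Qed.

(** The two cutoffs agree off [(U `\` K) `|` (U' `\` K')], so the values of the
    functional on them differ by at most the mass of this set. Hence the intervals centred at
    [coord_functional i eta] with radius [mass (U `\` K)] pairwise intersect. *)
Let coord_functional_close A K U eta K' U' eta' i :
  cutoff A K U eta -> cutoff A K' U' eta' ->
  coord_functional i eta - mass (U `\` K) <=
  coord_functional i eta' + mass (U' `\` K').
Proof.
move=> cut cut'; rewrite lerBlDr -addrA -lerBlDl.
have o1 := cutoff_diff_open cut; have o2 := cutoff_diff_open cut'.
have -> : coord_functional i eta - coord_functional i eta' =
    L (fun x => (eta x *: delta_mx 0 i : E) + -1 *: (eta' x *: delta_mx 0 i)).
  rewrite LD; [|exact: cutoff_fieldW cut|exact/Ckc_scale/cutoff_fieldW/cut'].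
  by rewrite LZ ?mulN1r//; exact: cutoff_fieldW cut'.
have fieldE x : (eta x *: delta_mx 0 i : E) + -1 *: (eta' x *: delta_mx 0 i) =
    (eta x - eta' x) *: delta_mx 0 i by rewrite scaleN1r scalerBl.
apply: (@le_trans _ _ (1 * mass ((U `\` K) `|` (U' `\` K')) + 0 * V)).
  apply: functional_le_offW => //.
  - exact: openU.
  - apply: Ckc_add; first exact: cutoff_fieldW cut.
    by apply: Ckc_scale; exact: cutoff_fieldW cut'.
  - move=> x; rewrite fieldE enormZ enorm_delta mulr1 ler_norml.
    by have := cutoff01 cut x; have := cutoff01 cut' x; lra.
  - move=> x Omx /not_orP[n1 n2]; rewrite fieldE.
    by rewrite (cutoff_indic cut)// (cutoff_indic cut')// subrr scale0r enorm0.
rewrite mul1r mul0r addr0 addrC -lee_fin EFinD !massE.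
exact: open_massU.
Qed.

(** A point common to all these intervals: the supremum of their left ends. *)
Definition coord_measure (i : 'I_d) A : R := sup
  [set r | exists K U eta, cutoff A K U eta /\
    r = coord_functional i eta - mass (U `\` K)].

Let coord_measure_close A K U eta i : measurable A -> cutoff A K U eta ->
  `|coord_functional i eta - coord_measure i A| <= mass (U `\` K).
Proof.
move=> mA cut; rewrite ler_distlC /coord_measure; set S := (X in sup X).
have hS : has_sup S.
  split; first by exists (coord_functional i eta - mass (U `\` K)), K, U, eta.
  exists (coord_functional i eta + mass (U `\` K)) => _ [K' [U' [eta' [cut' ->]]]].
  exact: coord_functional_close cut' cut.
apply/andP; split.
  by apply: sup_upper_bound => //; exists K, U, eta.
apply: ge_sup => [|_ [K' [U' [eta' [cut' ->]]]]]; first by case: hS.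
exact: coord_functional_close cut' cut.
Qed.

(** Replacing each indicator by a cutoff turns the step function into a field
    [\sum_k eta_k c_k]. Off the union of the [U_k `\` K_k], of arbitrarily small
    mass, its distance to [phi] on [Om] is at most [dl]; on this union the
    distance is bounded by a constant [C] independent of the cutoffs. *)
Theorem functional_le_step (I : finType) (A : I -> set E) (c : I -> E) phi dl :
  (forall k, measurable (A k)) -> Ckc 1 Om phi -> 0 <= dl ->
  (forall x, Om x -> enorm (phi x - \sum_k \1_(A k) x *: c k) <= dl) ->
  L phi <= \sum_k \sum_i c k 0 i * coord_measure i (A k) + dl * V.
Proof.
move=> mA Cphi dl0 phidl.
have [M M0 phiM] := Ckc_enorm_bounded Cphi.
pose C := M + \sum_k enorm (c k).
have C0 : 0 <= C by rewrite addr_ge0// sumr_ge0// => k _; exact: enorm_ge0.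
apply: (@ler_vanishing _ _ _ (C * #|I|%:R + \sum_k \sum_i `|c k 0 i|)).
  by rewrite addr_ge0 ?mulr_ge0// sumr_ge0// => k _; exact: sumr_ge0.
move=> e e0.
have /choice[p pP] k : exists p : set E * set E * (E -> R),
    cutoff (A k) p.1.1 p.1.2 p.2 /\ mass (p.1.2 `\` p.1.1) <= e.
  by have [K [U [eta]]] := exists_cutoff (mA k) e0; exists (K, U, eta).
pose K k := (p k).1.1; pose U k := (p k).1.2; pose eta k := (p k).2.
have cut k : cutoff (A k) (K k) (U k) (eta k) by have [] := pP k.
have small k : mass (U k `\` K k) <= e by have [] := pP k.
pose UK := \big[setU/set0]_k (U k `\` K k).
have oUK : open UK.
  rewrite /UK; elim/big_ind : _ => [|? ?|k _]; [exact: open0|exact: openU|].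
  exact: cutoff_diff_open (cut k).
have mUK : mass UK <= #|I|%:R * e.
  rewrite -lee_fin massE; apply: (le_trans (open_mass_bigsetU _ _)).
    by move=> k; exact: cutoff_diff_open (cut k).
  rewrite (eq_bigr (fun k => (mass (U k `\` K k))%:E)); last first.
    by move=> k _; rewrite massE.
  rewrite sumEFin lee_fin (le_trans (ler_sum _ (fun k _ => small k)))//.
  by rewrite sumr_const mulr_natl.
pose rest x := phi x + \sum_k -1 *: (eta k x *: c k).
have Cs : Ckc 1 Om (fun x => \sum_k (eta k x *: c k)).
  by apply: Ckc_sum => k; exact: cutoff_fieldW (cut k).
have Crest : Ckc 1 Om rest.
  apply: Ckc_add => //; apply: Ckc_sum => k; apply: Ckc_scale.
  exact: cutoff_fieldW (cut k).
have restE x : rest x = phi x - \sum_k (eta k x *: c k).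
  by rewrite /rest -scaler_sumr scaleN1r.
have -> : L phi = L rest + \sum_k L (fun x => eta k x *: c k).
  rewrite -functional_sum; last by move=> k; exact: cutoff_fieldW (cut k).
  rewrite -LD//; congr L; apply/funext => x.
  by rewrite restE subrK.
have Lrest : L rest <= C * mass UK + dl * V.
  apply: functional_le_offW => //.
    move=> x; rewrite restE (le_trans (ler_enormD _ _))// lerD//.
    rewrite -scaleN1r enormZ normrN1 mul1r (le_trans (ler_enorm_sum _ _))//.
    apply: ler_sum => k _; have /andP[p0 p1] := cutoff01 (cut k) x.
    by rewrite enormZ ger0_norm// ler_piMl// enorm_ge0.
  move=> x Omx nUK; rewrite restE.
  rewrite (eq_bigr (fun k => \1_(A k) x *: c k)); first exact: phidl.
  move=> k _; rewrite (cutoff_indic (cut k))//.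
  by apply: contra_not nUK => UKx; rewrite /UK (bigD1 k)//=; left.
apply: (@le_trans _ _ (C * mass UK + dl * V +
    \sum_k \sum_i (c k 0 i * coord_measure i (A k) + e * `|c k 0 i|))).
  apply: lerD => //; apply: ler_sum => k _; rewrite (functional_cutoff _ (cut k)).
  apply: ler_sum => i _; rewrite -lerBlDl -mulrBr.
  rewrite (le_trans (ler_norm _))// normrM mulrC ler_wpM2r//.
  exact: le_trans (coord_measure_close i (mA k) (cut k)) (small k).
under eq_bigr do rewrite big_split/= -mulr_sumr.
rewrite big_split/= -mulr_sumr mulrDr.
have : C * mass UK <= e * (C * #|I|%:R).
  by rewrite mulrCA ler_wpM2l// mulrC.
lra.
Qed.

Corollary functional_step (I : finType) (A : I -> set E) (c : I -> E) phi dl :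
  (forall k, measurable (A k)) -> Ckc 1 Om phi -> 0 <= dl ->
  (forall x, Om x -> enorm (phi x - \sum_k \1_(A k) x *: c k) <= dl) ->
  `|L phi - \sum_k \sum_i c k 0 i * coord_measure i (A k)| <= dl * V.
Proof.
move=> mA Cphi dl0 phidl; rewrite ler_distlC; apply/andP; split.
  by rewrite lerBlDr; exact: functional_le_step.
have : - L phi <= - (\sum_k \sum_i c k 0 i * coord_measure i (A k)) + dl * V.
  rewrite -[- L phi]mulN1r -LZ// -sumrN.
  rewrite [X in X + _](_ : _ =
      \sum_k \sum_i (- c k) 0 i * coord_measure i (A k)); last first.
    apply: eq_bigr => k _; rewrite -sumrN; apply: eq_bigr => i _.
    by rewrite mxE mulNr.
  apply: functional_le_step => //; first exact: Ckc_scale.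
  move=> x Omx; rewrite (eq_bigr (fun k => - (\1_(A k) x *: c k))); last first.
    by move=> k _; rewrite scalerN.
  rewrite sumrN scaleN1r -opprD -scaleN1r enormZ normrN1 mul1r.
  exact: phidl.
lra.
Qed.

Definition coord_vector A : E := \row_i coord_measure i A.

(** The field [eta c] is a competitor, up to the factor [enorm c], for the mass
    of [U]. *)
Lemma dot_coord_measure_le (c : E) A : measurable A ->
  \sum_i c 0 i * coord_measure i A <= enorm c * fine (nu (A `&` Om)).
Proof.
move=> mA.
apply: (@ler_vanishing _ _ _ (enorm c + \sum_i `|c 0 i|)).
  by rewrite addr_ge0 ?enorm_ge0 ?sumr_ge0.
move=> e e0; have [K [U [eta [cut small]]]] := exists_cutoff mA e0.
have oU := cutoff_open cut.
have mU : mass U <= fine (nu (A `&` Om)) + e.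
  have mK : measurable K by apply: measurable_compact; exact: cutoff_compact cut.
  have mAO : measurable (A `&` Om) by apply: measurableI => //; exact: open_measurable_mx.
  have mUK : measurable (U `\` K) by apply: measurableD => //; exact: open_measurable_mx.
  rewrite -lee_fin EFinD massE fineK ?nu_fin// -nu_open//.
  apply: (@le_trans _ _ (nu ((A `&` Om) `|` (U `\` K)))%E).
    apply: le_measure; rewrite ?inE; [exact: open_measurable_mx|exact: measurableU|].
    move=> x Ux; have [Kx|nKx] := pselect (K x); last by right.
    by left; exact: (cutoff_sub cut).
  have nUK : (nu (U `\` K) <= e%:E)%E.
    by rewrite nu_open -?massE ?lee_fin//; exact: cutoff_diff_open cut.
  by apply: (le_trans (measureU2 _ mAO mUK)); exact: leeD.
have h1 : L (fun x => eta x *: c) <= enorm c * mass U.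
  apply: functional_le_open_mass; first exact: enorm_ge0.
    by rewrite (setIidl (cutoff_Om cut)); exact: cutoff_field cut.
  move=> x; have /andP[e_0 e_1] := cutoff01 cut x.
  by rewrite enormZ ger0_norm// ler_piMl// enorm_ge0.
have h2 : \sum_i c 0 i * coord_measure i A <=
    \sum_i (c 0 i * coord_functional i eta + e * `|c 0 i|).
  apply: ler_sum => i _; rewrite -lerBlDl -mulrBr.
  rewrite (le_trans (ler_norm _))// normrM mulrC ler_wpM2r// distrC.
  exact: le_trans (coord_measure_close i mA cut) small.
rewrite (le_trans h2)// big_split/= -mulr_sumr -(functional_cutoff _ cut) mulrDr.
have : enorm c * mass U <= enorm c * (fine (nu (A `&` Om)) + e).
  by rewrite ler_wpM2l// enorm_ge0.
lra.
Qed.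

(** The previous bound with [c = coord_vector A]. The constant [1] here is what
    makes the total variation of the charges equal to [V]. *)
Lemma enorm_coord_vector_le A : measurable A ->
  enorm (coord_vector A) <= fine (nu (A `&` Om)).
Proof.
move=> mA; have [->|/enorm_gt0 n0] := eqVneq (coord_vector A) 0.
  by rewrite enorm0 fine_ge0.
rewrite -(ler_pM2l n0) -expr2 sqr_enorm.
rewrite (le_trans _ (dot_coord_measure_le (coord_vector A) mA))//.
by apply: ler_sum => i _; rewrite expr2 [in leLHS]mxE !mxE.
Qed.

Lemma coord_measure_le i A : measurable A ->
  `|coord_measure i A| <= fine (nu (A `&` Om)).
Proof.
move=> /enorm_coord_vector_le; apply: le_trans.
by rewrite (_ : coord_measure i A = coord_vector A 0 i) ?coord_le_enorm// mxE.
Qed.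

(** The step function with values [1], [1] and [-1] on [A], [B] and [A `|` B] is
    identically zero, so [functional_step] applies to the zero field with
    [dl = 0]. *)
Lemma coord_measureU i A B : measurable A -> measurable B -> A `&` B = set0 ->
  coord_measure i (A `|` B) = coord_measure i A + coord_measure i B.
Proof.
move=> mA mB AB.
pose F (k : 'I_3) := nth set0 [:: A; B; A `|` B] k.
pose c (k : 'I_3) : E := nth 0 [:: 1; 1; -1] k *: delta_mx 0 i.
have mF k : measurable (F k).
  by case: k => -[|[|[|//]]] ? //=; exact: measurableU.
have := @functional_step _ F c (fun=> 0) 0 mF (Ckc0 1 Om) (lexx 0).
have cE k : \sum_j c k 0 j * coord_measure j (F k) =
    nth 0 [:: 1; 1; -1] k * coord_measure i (F k).
  rewrite (bigD1 i)//= big1 ?addr0; last first.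
    by move=> j /negbTE ji; rewrite !mxE ji andbF mulr0 mul0r.
  by rewrite !mxE !eqxx mulr1.
under eq_bigr do rewrite cE.
rewrite mul0r !big_ord_recl big_ord0 /F/= addr0 functional0 => h.
have {h}/h : forall x, Om x -> enorm (0 - \sum_k \1_(F k) x *: c k) <= 0.
  move=> x _; rewrite !big_ord_recl big_ord0 /F /c /= addr0 !scalerA -!scalerDl.
  rewrite !indicE in_setU.
  rewrite (_ : _ *: _ = 0) ?subr0 ?enorm0//.
  have [Ax|Ax] := boolP (x \in A); have [Bx|Bx] := boolP (x \in B) => /=.
  - have : (A `&` B) x by split; [exact: set_mem Ax|exact: set_mem Bx].
    by rewrite AB.
  - by rewrite (_ : _ + _ = 0) ?scale0r//; ring.
  - by rewrite (_ : _ + _ = 0) ?scale0r//; ring.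
  - by rewrite (_ : _ + _ = 0) ?scale0r//; ring.
rewrite sub0r normrN normr_le0 => /eqP; lra.
Qed.

Lemma coord_measureI_Om i A : coord_measure i (A `&` Om) = coord_measure i A.
Proof.
congr (sup _); apply/seteqP; split=> r [K [U [eta [cut ->]]]];
  exists K, U, eta; split=> //.
  by case: cut; rewrite -setIA setIid => *; split.
by case: cut => *; split=> //; rewrite -setIA setIid.
Qed.

Lemma coord_vector_inner_regular A (e : R) : measurable A -> 0 < e ->
  exists K, [/\ compact K, K `<=` A `&` Om &
    enorm (coord_vector A) <= enorm (coord_vector K) + e].
Proof.
move=> mA e0; have [K [U [[cK oU] KA AU UOm le]]] := mass_regular mA e0.
have mK := measurable_compact cK.
have mAO : measurable (A `&` Om) by apply: measurableI => //; exact: open_measurable_mx.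
have mAK : measurable (A `&` Om `\` K) by exact: measurableD.
exists K; split => //.
have -> : coord_vector A = coord_vector K + coord_vector ((A `&` Om) `\` K).
  apply/rowP => i; rewrite !mxE -coord_measureI_Om -coord_measureU//.
    by rewrite setDUK.
  by rewrite setDIK.
apply: (le_trans (ler_enormD _ _)); rewrite lerD2l.
apply: (le_trans (enorm_coord_vector_le mAK)).
rewrite -lee_fin fineK ?nu_fin//.
have oUK : open (U `\` K) by exact: openD_compact.
apply: le_trans le; rewrite -nu_open//; apply: le_measure; rewrite ?inE.
- by apply: measurableI => //; exact: open_measurable_mx.
- exact: open_measurable_mx.
- by move=> x [[/AU Ux nKx] _]; split.
Qed.

Let coord_measure0 i : coord_measure i set0 = 0.
Proof.
apply/eqP; rewrite -normr_le0 (le_trans (coord_measure_le _ _))//.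
by rewrite set0I measure0.
Qed.

Lemma coord_measure_bigsetU i (F : nat -> set E) n :
  (forall k, measurable (F k)) -> trivIset setT F ->
  coord_measure i (\big[setU/set0]_(k < n) F k) = \sum_(k < n) coord_measure i (F k).
Proof.
move=> mF tF; elim: n => [|n IH]; first by rewrite !big_ord0.
rewrite !big_ord_recr/= coord_measureU// ?IH//; first exact: bigsetU_measurable.
by apply: (@trivIset_bigsetUI _ predT) => // j k _ _; exact: tF.
Qed.

(** Finite additivity and domination by the measure [nu]: the tails decrease to
    the empty set, so their [nu]-masses tend to [0]. *)
Lemma coord_measure_sigma_additive i :
  semi_sigma_additive (fun A => (coord_measure i A)%:E).
Proof.
move=> F mF tF mUF; set B := \bigcup_n F n.
pose B_ n := \big[setU/set0]_(k < n) F k.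
have mB_ n : measurable (B_ n) by exact: bigsetU_measurable.
have mOm : measurable Om := open_measurable_mx oOm.
rewrite (_ : (fun n => _) = fun n => (coord_measure i (B_ n))%:E); last first.
  by apply/funext => n; rewrite big_mkord sumEFin coord_measure_bigsetU.
apply: cvg_EFin; first by near=> n.
pose D n := (B `\` B_ n) `&` Om.
have mD n : measurable (D n) by apply: measurableI => //; exact: measurableD.
have D_ : \bigcap_n D n = set0.
  apply/seteqP; split => // x Dx; have [[[k _ Fkx] _] _] := Dx 0%N I.
  have [[_ nB] _] := Dx k.+1 I; apply: nB.
  by rewrite /B_ -bigcup_mkord; exists k => /=.
have cvgD : (fine (nu (D n)) @[n --> \oo] --> 0).
  apply/fine_cvg; rewrite -[X in _ --> X](measure0 nu) -D_.
  apply: nonincreasing_cvg_mu => //.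
  - by rewrite -ge0_fin_numE// nu_fin.
  - by rewrite D_.
  - apply/nonincreasing_seqP => n; rewrite subsetEset; apply: setSI.
    by apply: setDS; rewrite /B_ big_ord_recr; exact: subsetUl.
apply/cvgrPdist_le => e e0.
have /cvgrPdist_le/(_ e e0) := cvgD; apply: filterS => n.
rewrite sub0r normrN => /(le_trans (ler_norm _)); apply: le_trans.
have <- : coord_measure i (B `\` B_ n) = coord_measure i B - coord_measure i (B_ n).
  apply/eqP; rewrite eq_sym subr_eq addrC -coord_measureU//.
  - by rewrite setDUK//; exact: bigsetU_bigcup.
  - exact: measurableD.
  - by rewrite setDIK.
by apply: coord_measure_le; exact: measurableD.
Unshelve. all: by end_near. Qed.

(** The step-function inequality encodes the representation; it is turned into
    integrals only later, since it also yields the lower bound on the total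
    variation. *)
Theorem functional_charge : exists mu : 'I_d -> {charge set E -> \bar R},
  [/\ forall i A, mu i A = mu i (A `&` Om),
    forall (I : finType) (A : I -> set E) (c : I -> E) phi dl,
      (forall k, measurable (A k)) -> Ckc 1 Om phi -> 0 <= dl ->
      (forall x, Om x -> enorm (phi x - \sum_k \1_(A k) x *: c k) <= dl) ->
      `|L phi - \sum_k \sum_i c k 0 i * fine (mu i (A k))| <= dl * V,
    exists2 m : {measure set E -> \bar R}, (m setT <= V%:E)%E &
      forall A, measurable A -> ((enorm (vector_value mu A))%:E <= m A)%E &
    forall A e, measurable A -> 0 < e -> exists K,
      [/\ compact K, K `<=` A `&` Om &
        enorm (vector_value mu A) <= enorm (vector_value mu K) + e]].
Proof.
pose mu i : {charge set E -> \bar R} := HB.pack (fun A => (coord_measure i A)%:E)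
  (isCharge.Build _ E R (fun A => (coord_measure i A)%:E)
    (congr1 EFin (coord_measure0 i)) (fun _ _ => isT)
    (@coord_measure_sigma_additive i)).
have vE A : vector_value mu A = coord_vector A by [].
exists mu; split.
- by move=> i A /=; rewrite coord_measureI_Om.
- by move=> I A c phi dl mA Cphi dl0 h; exact: functional_step.
- exists nu; first by rewrite nuE; exact: outer_mass_le.
  move=> A mA; rewrite vE; apply: (@le_trans _ _ (fine (nu (A `&` Om)))%:E).
    by rewrite lee_fin enorm_coord_vector_le.
  rewrite fineK ?nu_fin// !nuE; apply: le_outer_mass; exact: subIsetl.
- by move=> A e mA e0; exact: coord_vector_inner_regular.
Qed.

End total_variation_measure.
(** * Integration against a charge *)

Section charge_integral.
Context d (T : measurableType d) (R : realType).
Implicit Types (D : set T) (f : T -> R).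

Lemma integral_near_step (m : {finite_measure set T -> \bar R}) D f (M : R)
    (I : finType) (A : I -> set T) (c : I -> R) (dl : R) :
  measurable D -> measurable_fun D f -> (forall x, D x -> `|f x| <= M) ->
  (forall k, measurable (A k)) ->
  (forall x, D x -> `|f x - \sum_k \1_(A k) x * c k| <= dl) ->
  `|\int[m]_(x in D) f x - \sum_k c k * fine (m (A k `&` D))| <= dl * fine (m D).
Proof.
move=> mD mf fM mA fdl; have mfin : (m D < +oo)%E by rewrite ltey_eq fin_num_measure.
have intf : m.-integrable D (EFin \o f).
  apply: measurable_bounded_integrable => //; exists M; split; first exact: num_real.
  by move=> y My x Dx; exact: (le_trans (fM x Dx) (ltW My)).
have int1 k : m.-integrable D (fun x => (\1_(A k) x)%:E).
  apply: (@integrableS _ _ _ _ setT) => //; exact: integrable_indic.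
have intck k : m.-integrable D (fun x => ((c k)%:E * (\1_(A k) x)%:E)%E).
  exact: integrableZl.
pose s x := \sum_k \1_(A k) x * c k.
have sE : EFin \o s = (fun x => \sum_k ((c k)%:E * (\1_(A k) x)%:E))%E.
  apply/funext => x /=; rewrite /s -sumEFin; apply: eq_bigr => k _.
  by rewrite -EFinM mulrC.
have ints : m.-integrable D (EFin \o s).
  by rewrite sE; apply: integrable_sum.
have intsE : \int[m]_(x in D) s x = \sum_k c k * fine (m (A k `&` D)).
  rewrite /Rintegral (_ : (fun x => (s x)%:E) = EFin \o s)// sE integral_sum//.
  have fE k : (\int[m]_(x in D) ((c k)%:E * (\1_(A k) x)%:E) =
      (c k * fine (m (A k `&` D)))%:E)%E.
    rewrite integralZl// integral_indic// EFinM fineK// fin_num_measure//.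
    exact: measurableI.
  by under eq_bigr do rewrite fE; rewrite sumEFin.
rewrite -intsE -RintegralB//.
have intB : m.-integrable D (EFin \o (fun x => f x - s x)).
  have := integrableB mD intf ints; congr (m.-integrable D).
apply: (le_trans (le_normr_Rintegral mD intB)).
rewrite -(Rintegral_cst m mD dl).
apply: le_Rintegral => //.
  by apply: (@integrable_abse _ _ _ m D (EFin \o (fun x => f x - s x))).
exact: finite_measure_integrable_cst.
Qed.


End charge_integral.

Section charge_integral_rV.
Context {R : realType} {d : nat}.
Local Notation E := 'rV[R]_d.
Implicit Types (D A U : set E) (f : E -> R) (nu : {charge set E -> \bar R}).

Lemma continuous_measurable_rV f : continuous f -> measurable_fun setT f.
Proof.
move=> cf; apply: (measurability _ (RGenOpens.measurableE R)).
move=> _ [_ [a [b ->]] <-]; rewrite setTI; apply: open_measurable_mx.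
by apply: open_comp => [x _|]; [exact: cf|exact: interval_open].
Qed.

Let jordan nu := svalP (cid (svalP (cid (Hahn_decomposition nu)))).

Let jordanE nu A : measurable A ->
  nu A = (jordan_pos (jordan nu) A - jordan_neg (jordan nu) A)%E.
Proof.
by move=> mA; rewrite (jordan_decomp (jordan nu) mA) /cadd/= cscaleN1.
Qed.

(** The estimate for finite measures is applied to both parts of the Jordan
    decomposition that defines the integral; [K] is the mass on [D] of the
    variation of [nu]. *)
Lemma charge_integral_near_step nu D : measurable D ->
  exists K : R, 0 <= K /\ forall f (M : R), measurable_fun D f ->
    (forall x, D x -> `|f x| <= M) ->
    charge_integral nu D f \is a fin_num /\
    forall (I : finType) (A : I -> set E) (c : I -> R) (dl : R),
      (forall k, measurable (A k)) ->
      (forall x, D x -> `|f x - \sum_k \1_(A k) x * c k| <= dl) ->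
      `|fine (charge_integral nu D f) - \sum_k c k * fine (nu (A k `&` D))| <=
      dl * K.
Proof.
move=> mD; set P := jordan_pos (jordan nu); set N := jordan_neg (jordan nu).
exists (fine (P D) + fine (N D)); split; first by rewrite addr_ge0// fine_ge0.
move=> f M mf fM.
have fin (m : {finite_measure set E -> \bar R}) :
    (\int[m]_(x in D) (f x)%:E)%E \is a fin_num.
  apply: integrable_fin_num => //.
  apply: measurable_bounded_integrable => //; first by rewrite ltey_eq fin_num_measure.
  exists M; split; first exact: num_real.
  by move=> y My x Dx; exact: (le_trans (fM x Dx) (ltW My)).
have finB : charge_integral nu D f \is a fin_num by rewrite fin_numB !fin.
split=> // I A c dl mA fdl.
have mAD k : measurable (A k `&` D) by exact: measurableI.
have -> : fine (charge_integral nu D f) =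
    \int[P]_(x in D) f x - \int[N]_(x in D) f x.
  by rewrite /charge_integral fineB ?fin.
have -> : \sum_k c k * fine (nu (A k `&` D)) =
    \sum_k c k * fine (P (A k `&` D)) - \sum_k c k * fine (N (A k `&` D)).
  rewrite -sumrB; apply: eq_bigr => k _; rewrite -mulrBr jordanE// fineB//;
    exact: fin_num_measure.
have hP := integral_near_step P mD mf fM mA fdl.
have hN := integral_near_step N mD mf fM mA fdl.
have distB (x y s t r r' : R) : `|x - s| <= r -> `|y - t| <= r' ->
    `|x - y - (s - t)| <= r + r'.
  move=> xs yt; rewrite (_ : x - y - (s - t) = (x - s) - (y - t)); last by ring.
  by rewrite (le_trans (ler_normB _ _))// lerD.
by rewrite mulrDr; exact: distB.
Qed.

(** Dominated convergence, by the constant [1], for both Jordan parts. *)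
Lemma charge_integral_dominated nu D (eta_ : nat -> E -> R) A :
  measurable D -> measurable A ->
  (forall n, continuous (eta_ n)) -> (forall n x, 0 <= eta_ n x <= 1) ->
  (forall x, D x -> eta_ n x @[n --> \oo] --> (\1_A x : R)) ->
  charge_integral nu D (eta_ n) @[n --> \oo] --> nu (A `&` D).
Proof.
move=> mD mA ceta eta01 etaA.
have cvg (m : {finite_measure set E -> \bar R}) :
    (\int[m]_(x in D) (eta_ n x)%:E)%E @[n --> \oo] --> m (A `&` D).
  rewrite -integral_indic//.
  have [] := @dominated_convergence _ _ _ m D mD (fun n x => (eta_ n x)%:E)
    (fun x => (\1_A x)%:E) (cst 1%E).
  - move=> n; apply/measurable_EFinP; apply: measurable_funTS.
    exact: continuous_measurable_rV.
  - by apply/measurable_EFinP; exact: measurable_indic.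
  - by apply: aeW => x Dx; apply: cvg_EFin; [near=> n|exact: etaA].
  - exact: finite_measure_integrable_cst.
  - apply: aeW => x n Dx /=; rewrite lee_fin.
    by have /andP[e0 e1] := eta01 n x; rewrite ger0_norm.
  by [].
have mAD : measurable (A `&` D) by exact: measurableI.
rewrite jordanE//; apply: cvgeB.
- by rewrite fin_num_adde_defr// fin_num_measure.
- exact: cvg.
- exact: cvg.
Unshelve. all: by end_near. Qed.

(** Closed bounded sets are compact: take the points of norm at most [n] at
    distance at least [1 / (n + 1)] from the complement of [U]. *)
Lemma open_compact_exhaustion U : open U -> exists K : nat -> set E,
  (forall n, compact (K n) /\ K n `<=` U) /\
  (forall x, U x -> \forall n \near \oo, K n x).
Proof.
move=> oU; pose K n := [set x : E | `|x| <= n%:R /\ ball x n.+1%:R^-1 `<=` U].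
exists K; split=> [n|x Ux].
  split; last by move=> x [_]; apply; apply: ballxx; rewrite invr_gt0.
  apply: bounded_closed_compact.
    exists n%:R; split; first exact: num_real.
    by move=> y ny x [xn _]; exact: le_trans xn (ltW ny).
  rewrite (_ : K n = [set x | `|x| <= n%:R] `&`
     ~` \bigcup_(y in ~` U) ball y n.+1%:R^-1); last first.
    apply/seteqP; split=> x [xn xU]; split => //.
      by move=> [y nUy /ball_sym /xU].
    by move=> y xy; apply: contrapT => nUy; apply: xU; exists y => //; exact: ball_sym.
  apply: closedI; last first.
    by apply: open_closedC; apply: bigcup_open => y _; exact: ball_open.
  apply: (@closed_comp _ _ (fun x : E => `|x|) [set r : R | r <= n%:R]).
    by move=> x _; exact: norm_continuous.
  exact: closed_le.
have /nbhs_ballP[e /= e0 xe] := open_nbhs_nbhs (conj oU Ux).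
near=> n; split.
  by near: n; exact: nbhs_infty_ger.
apply: subset_trans xe; apply: le_ball; apply: ltW.
by near: n; exact: (near_infty_natSinv_lt (PosNum e0)).
Unshelve. all: by end_near. Qed.

(** Smooth cutoffs along an exhaustion converge boundedly to the indicator of
    an open set, so the two charges agree on open sets. Uniqueness of measures
    is then applied to the sums of Jordan parts [P + N'] and [P' + N], whose
    equality on a set amounts to that of [nu = P - N] and [nu' = P' - N']. *)
Lemma charge_eq_of_smooth nu nu' (Om : set E) : open Om ->
  (forall A, measurable A -> nu A = nu (A `&` Om)) ->
  (forall A, measurable A -> nu' A = nu' (A `&` Om)) ->
  (forall eta, (forall k, Ck k eta) ->
    (exists2 C, compact C /\ C `<=` Om & forall x, ~ C x -> eta x = 0) ->
    charge_integral nu Om eta = charge_integral nu' Om eta) ->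
  forall A, measurable A -> nu A = nu' A.
Proof.
have arith (p n p' n' : R) : p - n = p' - n' <-> p + n' = p' + n.
  by split; lra.
move=> oOm nuOm nu'Om nunu'.
have mOm : measurable Om := open_measurable_mx oOm.
have openE U : open U -> nu (U `&` Om) = nu' (U `&` Om).
  move=> oU; have mU := open_measurable_mx oU.
  have oUO : open (U `&` Om) by exact: openI.
  have [K [KP Kx]] := open_compact_exhaustion oUO.
  have /choice[eta_ etaP] n : exists eta : E -> R, [/\ forall k, Ck k eta,
      forall x, 0 <= eta x <= 1, forall x, K n x -> eta x = 1 &
      exists2 C, compact C /\ C `<=` U `&` Om & forall x, ~ C x -> eta x = 0].
    have [cK KU] := KP n.
    have [eta [Ceta eta01 [W [_ KW] W1] supp]] := smooth_cutoff cK oUO KU.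
    by exists eta; split => // x /KW/W1.
  have ceta n : continuous (eta_ n).
    by have [/(_ 0%N)] := etaP n.
  have eta01 n x : 0 <= eta_ n x <= 1 by have [] := etaP n.
  have etaU x : Om x -> eta_ n x @[n --> \oo] --> (\1_U x : R).
    move=> Omx; rewrite indicE; apply: cvg_near_cst.
    have [Ux|nUx] := pselect (U x).
      rewrite mem_set//; apply: filterS (Kx x (conj Ux Omx)) => n Knx.
      by have [_ _ ->] := etaP n.
    rewrite memNset//; apply: nearW => n.
    by have [_ _ _ [C [_ CU] ->]] := etaP n => // /CU[].
  have h (m : {charge set E -> \bar R}) :
      charge_integral m Om (eta_ n) @[n --> \oo] --> m (U `&` Om).
    exact: charge_integral_dominated.
  apply: (cvg_unique _ (h nu)) => //; move: (h nu').
  rewrite (_ : (fun n => _) = fun n => charge_integral nu Om (eta_ n))//.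
  apply/funext => n; apply/esym/nunu'; first by have [] := etaP n.
  have [_ _ _ [C [cC CU] C0]] := etaP n.
  by exists C => //; split => // x /CU[].
move=> A mA; rewrite nuOm// nu'Om//.
set P := jordan_pos (jordan nu); set N := jordan_neg (jordan nu).
set P' := jordan_pos (jordan nu'); set N' := jordan_neg (jordan nu').
have eqE B : measurable B -> (nu (B `&` Om) = nu' (B `&` Om)) <->
    ((P (B `&` Om) + N' (B `&` Om) = P' (B `&` Om) + N (B `&` Om))%E).
  move=> mB; have mBO : measurable (B `&` Om) by exact: measurableI.
  have := jordanE nu mBO; have := jordanE nu' mBO; rewrite -/P -/N -/P' -/N'.
  move=> -> ->.
  have -> : P (B `&` Om) = (fine (P (B `&` Om)))%:E by rewrite fineK// fin_num_measure.
  have -> : N (B `&` Om) = (fine (N (B `&` Om)))%:E by rewrite fineK// fin_num_measure.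
  have -> : P' (B `&` Om) = (fine (P' (B `&` Om)))%:E by rewrite fineK// fin_num_measure.
  have -> : N' (B `&` Om) = (fine (N' (B `&` Om)))%:E by rewrite fineK// fin_num_measure.
  by rewrite -!EFinB -!EFinD; split=> -[/arith ?]; congr (_%:E).
apply/(eqE A mA).
pose m1 : {measure set E -> \bar R} := measure_add (mrestr P mOm) (mrestr N' mOm).
pose m2 : {measure set E -> \bar R} := measure_add (mrestr P' mOm) (mrestr N mOm).
have m1E B : m1 B = (P (B `&` Om) + N' (B `&` Om))%E by exact: measure_addE.
have m2E B : m2 B = (P' (B `&` Om) + N (B `&` Om))%E by exact: measure_addE.
rewrite -m1E -m2E; apply: (@measure_unique _ R E (@open E) (fun=> setT)) => //.
- by move=> U W; exact: openI.
- by move=> _; exact: openT.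
- by rewrite bigcup_const//; exists 0%N.
- move=> U oU; rewrite m1E m2E.
  by apply/(eqE U (open_measurable_mx oU)); exact: openE.
- move=> _; rewrite m1E ltey_eq fin_numD.
  have mTO : measurable (setT `&` Om) by exact: measurableI.
  by rewrite !fin_num_measure.
Qed.

End charge_integral_rV.
(** * Total variation of a vector of charges *)

Section vector_charges.
Context {R : realType} {d : nat}.
Local Notation E := 'rV[R]_d.
Implicit Types (A K Om : set E) (phi : E -> E).
Implicit Type mu : 'I_d -> {charge set E -> \bar R}.

(** The support is compact, so finitely many of the open sets on which [phi]
    varies by less than [dl] cover it. *)
Lemma Ckc_step k Om phi (dl : R) : Ckc k Om phi -> 0 < dl ->
  exists n (F : nat -> set E) (c : nat -> E), [/\ forall j, measurable (F j),
    trivIset setT F,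
    forall x, enorm (phi x - \sum_(j < n) \1_(F j) x *: c j) <= dl &
    forall j, exists x, c j = phi x].
Proof.
move=> /CkcP[Cphi [C [cC COm] C0]] dl0.
pose O x := [set y | enorm (phi y - phi x) < dl].
have oO x : open (O x).
  have cphi : continuous (enorm \o (fun y => phi y - phi x)).
    apply: continuous_enorm => i.
    rewrite (_ : (fun _ => _) = fun y => phi y 0 i + - phi x 0 i).
      apply: continuous_add; last exact: cst_continuous.
      exact: Ck_continuous (Cphi i).
    by apply/funext => y; rewrite !mxE.
  by have := (continuousP _).1 cphi _ (@open_lt _ dl).
have : cover_compact C by rewrite -compact_cover.
case/(_ E C O) => [x _|x Cx|D DC CD]; first exact: oO.
  by exists x => //; rewrite /O /= subrr enorm0.
pose s : seq E := enum_fset D; pose G j := O (nth 0 s j).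
pose F j := C `&` seqDU G j.
have tF : trivIset setT F.
  move=> i j _ _ [x [[_ Fi] [_ Fj]]].
  by apply: (trivIset_seqDU G) => //; exists x.
exists (size s), F, (fun j => phi (nth 0 s j)); split => //.
- move=> j; apply: measurableI; first exact: measurable_compact.
  by apply: seqDU_measurable => i; apply: open_measurable_mx; exact: oO.
- move=> x; have [Cx|nCx] := pselect (C x); last first.
    rewrite C0// big1 ?subr0 ?enorm0 ?(ltW dl0)// => j _.
    by rewrite indicE memNset ?scale0r// => -[].
  have [y /= yD Oyx] := CD _ Cx.
  have : (\big[setU/set0]_(j < size s) G j) x.
    rewrite -bigcup_mkord; exists (index y s); first by rewrite /= index_mem.
    by rewrite /G nth_index.
  rewrite bigsetU_seqDU -bigcup_mkord => -[j /= js Fjx].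
  rewrite (bigD1 (Ordinal js))//= big1 => [|i ij]; last first.
    rewrite indicE memNset ?scale0r// => -[_ Fix].
    move/eqP: ij; apply; apply: val_inj => /=.
    by apply: (trivIset_seqDU G) => //; exists x.
  rewrite indicE mem_set ?scale1r ?addr0; last by split.
  by apply: ltW; exact: (subset_seqDU Fjx).
by move=> j; exists (nth 0 s j).
Qed.

(** The first [n] sets are completed to a partition of [A] by one remainder and
    empty sets. *)
Lemma vector_variation_ge mu A (F : nat -> set E) n : measurable A ->
  (forall k, measurable (F k)) -> trivIset setT F -> (forall k, F k `<=` A) ->
  ((\sum_(k < n) enorm (vector_value mu (F k)))%:E <= vector_variation mu A)%E.
Proof.
move=> mA mF tF FA.
pose B := \big[setU/set0]_(k < n) F k.
have mB : measurable B by exact: bigsetU_measurable.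
pose G k := if (k < n)%N then F k else if k == n then A `\` B else set0.
have GF k : (k < n)%N -> G k = F k by rewrite /G => ->.
apply: (@le_trans _ _ (\sum_(0 <= k <oo) (enorm (vector_value mu (G k)))%:E)%E).
  rewrite -sumEFin (eq_bigr (fun k : 'I_n => (enorm (vector_value mu (G k)))%:E)).
    rewrite -(big_mkord xpredT (fun k => (enorm (vector_value mu (G k)))%:E)).
    by apply: nneseries_lim_ge => k _ _; rewrite lee_fin enorm_ge0.
  by move=> k _; rewrite GF.
apply: ereal_sup_ubound; exists G => //; split.
- move=> k; rewrite /G; case: ifPn => // _; case: ifPn => // _.
  exact: measurableD.
- have FB k x : (k < n)%N -> F k x -> B x.
    by move=> kn Fkx; rewrite /B -bigcup_mkord; exists k.
  move=> i j _ _ [x [+ +]]; rewrite /G.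
  case: ltnP => ni; last (case: eqP => // -> [_ nB]); case: ltnP => nj.
  + by move=> Fi Fj; apply: tF => //; exists x.
  + by move=> Fi; case: eqP => // -> [_ nB]; case: nB; exact: FB Fi.
  + by move=> Fj; case: nB; exact: FB Fj.
  + by case: eqP.
- apply/seteqP; split=> x.
    move=> [k _]; rewrite /G; case: ifPn => [_ /FA//|_].
    by case: ifPn => // _ [].
  move=> Ax; have [Bx|nBx] := pselect (B x).
    by move: Bx; rewrite /B -bigcup_mkord => -[k /= kn Fk]; exists k => //; rewrite GF.
  by exists n => //; rewrite /G ltnn eqxx.
Qed.

Lemma vector_variation_le mu A (S : \bar R) :
  (forall (F : nat -> set E) n, (forall k, measurable (F k)) -> trivIset setT F ->
    \bigcup_k F k = A -> (\sum_(k < n) enorm (vector_value mu (F k)))%:E <= S)%E ->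
  (vector_variation mu A <= S)%E.
Proof.
move=> h; apply: ge_ereal_sup => _ [F [mF tF FA] <-].
apply: lime_le; first by apply: is_cvg_nneseries => k _ _; rewrite lee_fin enorm_ge0.
by apply: nearW => n; rewrite big_mkord sumEFin; exact: h.
Qed.

(** Given a partition of [A], the first [n] pieces are approximated by compact
    subsets, which are pieces of their own compact union. *)
Lemma vector_variation_inner_regular mu Om A :
  (forall A (e : R), measurable A -> 0 < e -> exists K,
    [/\ compact K, K `<=` A `&` Om &
      enorm (vector_value mu A) <= enorm (vector_value mu K) + e]) ->
  measurable A ->
  vector_variation mu A =
  ereal_sup [set vector_variation mu K | K in [set K | compact K /\ K `<=` A]].
Proof.
move=> reg mA; apply/eqP; rewrite eq_le; apply/andP; split; last first.
  apply: ge_ereal_sup => _ [K [cK KA] <-]; apply: vector_variation_le => F n mF tF FK.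
  apply: vector_variation_ge => // k; apply: subset_trans KA; rewrite -FK.
  exact: bigcup_sup.
apply: vector_variation_le => F n mF tF FA; apply/lee_addgt0Pr => e e0.
have en : 0 < e / n.+1%:R by rewrite divr_gt0.
have /choice[K KP] k : exists K, [/\ compact K, K `<=` F k &
    enorm (vector_value mu (F k)) <= enorm (vector_value mu K) + e / n.+1%:R].
  have [K [cK KF le]] := reg _ _ (mF k) en.
  by exists K; split => // x /KF[].
pose C := \big[setU/set0]_(k < n) K k.
have cC : compact C by apply: bigsetU_compact => k _; have [] := KP k.
have CA : C `<=` A.
  rewrite /C -bigcup_mkord -FA => x [k _ Kx]; exists k => //.
  by have [_ + _] := KP k; exact.
pose K' k := if (k < n)%N then K k else set0.
apply: (@le_trans _ _ (vector_variation mu C + e%:E)%E); last first.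
  by apply: leeD => //; apply: ereal_sup_ubound; exists C.
apply: (@le_trans _ _ ((\sum_(k < n) enorm (vector_value mu (K' k)))%:E + e%:E)%E).
  rewrite -EFinD lee_fin.
  apply: (@le_trans _ _ (\sum_(k < n) (enorm (vector_value mu (K' k)) + e / n.+1%:R))).
    by apply: ler_sum => k _; rewrite /K' ltn_ord; have [] := KP k.
  rewrite big_split/= lerD2l sumr_const card_ord -[_ *+ n]mulr_natr.
  by rewrite -mulrA ler_piMr ?(ltW e0)// mulrC ler_pdivrMr// mul1r ler_nat.
apply: leeD => //; apply: vector_variation_ge.
- exact: measurable_compact.
- move=> k; rewrite /K'; case: ifPn => // _.
  by apply: measurable_compact; have [] := KP k.
- move=> i j _ _ [x [+ +]]; rewrite /K'; case: ifPn => // _ Ki; case: ifPn => // _ Kj.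
  apply: tF => //; exists x; split.
    by have [_ + _] := KP i; exact.
  by have [_ + _] := KP j; exact.
- move=> k; rewrite /K'; case: ifPn => [kn x Kx|_]; last exact: sub0set.
  by rewrite /C -bigcup_mkord; exists k.
Qed.

End vector_charges.

(** * The divergence associated with the Hardy operator *)

Section hardy_divergence.
Context {R : realType} {d : nat}.
Local Notation E := 'rV[R]_d.
Variables (a : R) (Om : set E).
Hypotheses (oOm : open Om) (Om0 : Om `<=` ~` [set 0]).
Implicit Types (phi psi : E -> E) (f : E -> R).

Let C1_derivable phi i x : Ckc 1 Om phi ->
  derivable (fun y => phi y 0 i) x (delta_mx 0 i).
Proof. by case=> /(_ i)[_ /(_ i)[+ _]] _ _; exact. Qed.

Lemma div_HD phi psi : Ckc 1 Om phi -> Ckc 1 Om psi ->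
  div_H a (fun x => phi x + psi x) = fun x => div_H a phi x + div_H a psi x.
Proof.
move=> Cphi Cpsi; apply/funext => x; rewrite /div_H -big_split/=.
apply: eq_bigr => i _; rewrite /A_H /partial_deriv.
rewrite (_ : (fun y => (phi y + psi y) 0 i) =
    (fun y => phi y 0 i) + (fun y => psi y 0 i)); last first.
  by apply/funext => y; rewrite mxE.
by rewrite deriveD ?mxE; [ring|exact: C1_derivable|exact: C1_derivable].
Qed.

Lemma div_HZ (c : R) phi : Ckc 1 Om phi ->
  div_H a (fun x => c *: phi x) = fun x => c * div_H a phi x.
Proof.
move=> Cphi; apply/funext => x; rewrite /div_H mulr_sumr.
apply: eq_bigr => i _; rewrite /A_H /partial_deriv.
rewrite (_ : (fun y => (c *: phi y) 0 i) = c \*: (fun y => phi y 0 i)); last first.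
  by apply/funext => y; rewrite mxE.
rewrite deriveZ ?mxE; last exact: C1_derivable.
have scaleE (r s : R) : r *: s = r * s by [].
by rewrite scaleE; ring.
Qed.

(** The drift is singular only at the origin, which lies outside of [Om]. *)
Lemma div_H_continuous phi x : Ckc 1 Om phi -> Om x ->
  {for x, continuous (div_H a phi)}.
Proof.
move=> Cphi Omx; have [Ck1 _ _] := Cphi.
have x0 : enorm x * enorm x != 0.
  by rewrite -expr2 expf_neq0// gt_eqF// enorm_gt0//; apply/eqP; exact: Om0.
have cn : continuous (fun y : E => enorm y).
  by apply: (@continuous_enorm _ _ _ id) => j; exact: coord_continuous.
apply: continuous_at_sum => i.
have -> : (fun y => A_H a i (fun z => phi z 0 i) y) = (fun y =>
    partial_deriv i (fun z => phi z 0 i) y +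
    - @hardy_sigma R d a * (y 0 i * (enorm y * enorm y)^-1) * phi y 0 i).
  by apply/funext => y; rewrite /A_H expr2; ring.
have [cphi /(_ i)[_ cd]] := Ck1 i.
apply: (continuousD (cd x)); apply: continuousM; last exact: cphi.
apply: continuousM; first exact: cst_continuous.
apply: continuousM; first exact: coord_continuous.
apply: (@continuousV _ _ (fun y : E => enorm y * enorm y) x x0).
exact: (continuousM (cn x) (cn x)).
Qed.

(** Near a point off the closed set [C] the field vanishes, so that its partial
    derivatives vanish too. *)
Lemma div_H_support phi (C : set E) x : closed C -> (forall x, ~ C x -> phi x = 0) ->
  ~ C x -> div_H a phi x = 0.
Proof.
move=> clC C0 nCx; apply: big1 => i _.
rewrite /A_H C0// mxE mulr0 subr0 /partial_deriv derive_lineE.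
have nearC : \forall h \near (0 : R), ~ C (h *: delta_mx 0 i + x).
  have line : (h *: delta_mx 0 i + x : E) @[h --> (0 : R)] --> x.
    rewrite -[X in _ --> X]add0r; apply: cvgD; last exact: cvg_cst.
    rewrite -[X in _ --> X](scale0r (delta_mx 0 i)).
    by apply: cvgZr_tmp; exact: cvg_id.
  apply: (line (~` C)); apply: open_nbhs_nbhs; split => //.
  exact: closed_openC.
have /(@is_derive_near _ (cst 0)) : \forall h \near (0 : R),
    cst 0 h = phi (h *: delta_mx 0 i + x) 0 i.
  by apply: filterS nearC => h /C0 ->; rewrite mxE.
by move=> /(_ _ (is_derive_cst _ _ _))[].
Qed.

Lemma div_H_measurable phi : Ckc 1 Om phi -> measurable_fun Om (div_H a phi).
Proof.
have open_of_interior (S : set E) : S `<=` interior S -> open S by rewrite openE.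
move=> Cphi; apply: (measurability _ (RGenOpens.measurableE R)).
move=> _ [_ [r [s ->]] <-]; apply: open_measurable_mx.
apply: open_of_interior => x [Omx rs]; apply: filterI; first exact: open_nbhs_nbhs.
by apply: (div_H_continuous Cphi Omx); apply: open_nbhs_nbhs; split.
Qed.

Lemma div_H_bounded phi : Ckc 1 Om phi -> exists M : R, forall x, `|div_H a phi x| <= M.
Proof.
move=> Cphi; have /CkcP[_ [C [cC COm] C0]] := Cphi.
have clC := compact_closed_rV cC.
have cdiv : {within C, continuous (div_H a phi)}.
  apply: continuous_in_subspaceT => x /set_mem Cx.
  exact: div_H_continuous (COm _ Cx).
have [M [_ MC]] := compact_bounded (continuous_compact cdiv cC).
exists (`|M| + 1) => x; have [Cx|nCx] := pselect (C x).
  by apply: (MC (`|M| + 1)); [rewrite ltr_pwDr// ler_norm|exists x].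
by rewrite (div_H_support clC C0 nCx) normr0 addr_ge0.
Qed.

End hardy_divergence.

(** * The structure theorem *)

Theorem lemma2p4 (R : realType) (d : nat) (a : R) (Omega : set 'rV[R]_d)
    (u : 'rV[R]_d -> R) :
  (2 <= d)%N ->
  - (d%:R / 2 - 1) ^+ 2 <= a ->
  is_domain Omega -> Omega `<=` ~` [set 0] ->
  BV_H a Omega u ->
  exists mu : 'I_d -> {charge set 'rV[R]_d -> \bar R},
    [/\ finite_radon_measure Omega mu,
        represents_H a Omega u mu,
        variation_H a Omega u = vector_variation mu Omega &
        forall mu' : 'I_d -> {charge set 'rV[R]_d -> \bar R},
          finite_radon_measure Omega mu' -> represents_H a Omega u mu' ->
          forall i A, measurable A -> mu' i A = mu i A].
Proof.
move=> _ _ [oOm _ _] Om0 [intu varu].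
have mOm : measurable Omega := open_measurable_mx oOm.
pose L phi := \int[lebesgue_rV d]_(x in Omega) (u x * div_H a phi x).
have intL phi : Ckc 1 Omega phi ->
    (lebesgue_rV d).-integrable Omega (EFin \o (fun x => u x * div_H a phi x)).
  move=> Cphi; have [M MP] := div_H_bounded a Om0 Cphi.
  apply: (integrableMl mOm intu); first exact: div_H_measurable.
  exists M; split; first exact: num_real.
  by move=> y My x _; exact: le_trans (MP x) (ltW My).
have LE phi : Ckc 1 Omega phi ->
    (\int[lebesgue_rV d]_(x in Omega) (u x * div_H a phi x)%:E)%E = (L phi)%:E.
  by move=> Cphi; rewrite fineK// integrable_fin_num//; exact: intL.
have LD phi psi : Ckc 1 Omega phi -> Ckc 1 Omega psi ->
    L (fun x => phi x + psi x) = L phi + L psi.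
  move=> Cphi Cpsi; rewrite /L (div_HD _ Cphi Cpsi) -RintegralD//; try exact: intL.
  by apply: eq_Rintegral => x _; rewrite mulrDr.
have LZ c phi : Ckc 1 Omega phi -> L (fun x => c *: phi x) = c * L phi.
  move=> Cphi; rewrite /L (div_HZ _ _ Cphi) -RintegralZl//; last exact: intL.
  by apply: eq_Rintegral => x _; rewrite mulrCA.
have L_var phi : Ckc 1 Omega phi -> (forall x, Omega x -> enorm (phi x) <= 1) ->
    ((L phi)%:E <= variation_H a Omega u)%E.
  by move=> Cphi phi1; rewrite -LE//; apply: ereal_sup_ubound; exists phi.
have var0 : (0 <= variation_H a Omega u)%E.
  apply: (le_trans _ (L_var (fun=> 0) (Ckc0 _ _) _)) => [|x _]; last by rewrite enorm0.
  rewrite (_ : L _ = 0)//; have := LZ 0 _ (Ckc0 1 Omega); rewrite mul0r => <-.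
  by congr L; apply/funext => x; rewrite scaler0.
have varE : variation_H a Omega u = (fine (variation_H a Omega u))%:E.
  by rewrite fineK// ge0_fin_numE.
set V := fine (variation_H a Omega u) in varE.
have LV phi : Ckc 1 Omega phi -> (forall x, enorm (phi x) <= 1) -> L phi <= V.
  by move=> Cphi phi1; rewrite -lee_fin -varE; exact: L_var.
have [mu [muOm mu_step [m mV mu_m] mu_reg]] := functional_charge oOm LD LZ LV.
have muOm_fine i A : fine (mu i (A `&` Omega)) = fine (mu i A).
  by rewrite -muOm.
have V0 : 0 <= V by rewrite -lee_fin -varE.
(* Both sides lie within a multiple of [dl] of the same sum over a step
   function close to the field, for every [dl > 0]. *)
have rep : represents_H a Omega u mu.
  move=> phi Cinf; have Cphi := Cinf 1%N; rewrite LE// /vector_integral.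
  have [B B0 phiB] := Ckc_enorm_bounded Cphi.
  have mphi i : measurable_fun Omega (fun x => phi x 0 i).
    apply: measurable_funTS; apply: continuous_measurable_rV.
    by have [/(_ i)/Ck_continuous] := Cphi.
  have phiBi i x : Omega x -> `|phi x 0 i| <= B.
    by move=> _; exact: le_trans (coord_le_enorm _ _) (phiB x).
  have /choice[K KP] i := charge_integral_near_step (mu i) mOm.
  have fin i : charge_integral (mu i) Omega (fun x => phi x 0 i) \is a fin_num.
    by have [_ /(_ _ _ (mphi i) (phiBi i))[]] := KP i.
  rewrite (eq_bigr (fun i => (fine (charge_integral (mu i) Omega
    (fun x => phi x 0 i)))%:E)); last by move=> i _; rewrite fineK.
  rewrite sumEFin; congr (_%:E); apply/eqP; rewrite -subr_eq0 -normr_le0.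
  apply: (@ler_vanishing _ _ _ (V + \sum_i K i)).
    by rewrite addr_ge0// sumr_ge0// => i _; have [] := KP i.
  move=> dl dl0; rewrite add0r mulrDr mulr_sumr.
  have [n [F [c [mF _ phiF _]]]] := Ckc_step Cphi dl0.
  have mF' (k : 'I_n) : measurable (F k) by exact: mF.
  have h1 := mu_step _ (fun k : 'I_n => F k) (fun k : 'I_n => c k) phi dl mF' Cphi (ltW dl0)
    (fun x _ => phiF x).
  have h2 i : `|fine (charge_integral (mu i) Omega (fun x => phi x 0 i)) -
      \sum_(k < n) c k 0 i * fine (mu i (F k))| <= dl * K i.
    have [_ /(_ _ _ (mphi i) (phiBi i))[_]] := KP i.
    move=> /(_ _ (fun k : 'I_n => F k) (fun k : 'I_n => c k 0 i) dl mF').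
    under eq_bigr do rewrite muOm_fine.
    apply=> x _; apply: le_trans (phiF x).
    apply: le_trans (coord_le_enorm _ i); rewrite !mxE summxE.
    by under [in leRHS]eq_bigr do rewrite mxE.
  rewrite exchange_big/= in h1.
  set S := \sum_i _ in h1.
  rewrite (_ : _ - _ = (L phi - S) + (S - \sum_i fine (charge_integral (mu i) Omega
    (fun x => phi x 0 i)))); last by ring.
  rewrite (le_trans (ler_normD _ _))// lerD//.
  rewrite -sumrB (le_trans (ler_norm_sum _ _ _))//.
  by apply: ler_sum => i _; rewrite distrC.
exists mu; split => //.
- split; first by move=> i A _; exact: muOm.
  by move=> A mA _; exact: vector_variation_inner_regular mu_reg mA.
- apply/eqP; rewrite eq_le; apply/andP; split; last first.
    rewrite varE; apply: le_trans mV.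
    apply: vector_variation_le => F n mF tF FOm.
    rewrite -sumEFin; apply: (@le_trans _ _ (\sum_(k < n) m (F k))%E).
      by apply: lee_sum => k _; exact: mu_m.
    rewrite -measure_semi_additive//; last exact: bigsetU_measurable.
    by apply: le_measure; rewrite ?inE//; exact: bigsetU_measurable.
  (* The values [c k] are values of the field, so they have norm at most [1]
     and [c k . mu (F k) <= |mu (F k)|]. *)
  apply: ge_ereal_sup => _ [phi [Cphi phi1] <-]; rewrite LE//.
  apply/lee_addgt0Pr => e e0.
  have V1 : 0 < V + 1 by rewrite ltr_wpDl.
  pose dl := e / (V + 1); have dl0 : 0 < dl by rewrite divr_gt0.
  have phi1' x : enorm (phi x) <= 1.
    have [Ox|nOx] := pselect (Omega x); first exact: phi1.
    have /CkcP[_ [C [_ COm] C0]] := Cphi.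
    by rewrite C0 ?enorm0// => /COm.
  have [n [F [c [mF tF phiF cphi]]]] := Ckc_step Cphi dl0.
  have mF' (k : 'I_n) : measurable (F k) by exact: mF.
  have h1 := mu_step _ (fun k : 'I_n => F k) (fun k : 'I_n => c k) phi dl mF' Cphi (ltW dl0)
    (fun x _ => phiF x).
  pose G k := F k `&` Omega.
  have mG k : measurable (G k) by exact: measurableI.
  have tG : trivIset setT G.
    by move=> i j _ _ [x [[Fi _] [Fj _]]]; apply: tF => //; exists x.
  have GO k : G k `<=` Omega by exact: subIsetr.
  apply: (le_trans _ (leeD (vector_variation_ge mu n mOm mG tG GO) (lexx e%:E))).
  rewrite -EFinD lee_fin.
  have h2 : \sum_(k < n) \sum_i c k 0 i * fine (mu i (F k)) <=
      \sum_(k < n) enorm (vector_value mu (G k)).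
    apply: ler_sum => k _; have [x ck] := cphi k.
    apply: (@le_trans _ _ (enorm (c k) * enorm (vector_value mu (G k)))).
      rewrite (le_trans _ (dot_le_enorm _ _))//; apply: ler_sum => i _.
      by rewrite mxE muOm_fine.
    by rewrite ler_piMl ?enorm_ge0// ck.
  have dlV : dl * V <= e.
    rewrite /dl -mulrA ler_piMr ?(ltW e0)// mulrC ler_pdivrMr// mul1r.
    by rewrite lerDl.
  by move: h1; rewrite ler_norml; lra.
move=> mu' [mu'Om _] rep' i A mA.
apply: (@charge_eq_of_smooth _ _ _ _ Omega) => //.
  by move=> B mB; exact: mu'Om.
move=> eta Ceta supp.
have Cinf : Cinfc Omega (fun x => eta x *: delta_mx 0 i).
  move=> k; apply/CkcP; split.
    by move=> j; under eq_fun do rewrite mxE; apply: Ck_mul => //; exact: Ck_cst.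
  by have [C cC C0] := supp; exists C => // x /C0 ->; rewrite scale0r.
have ci0 (nu : {charge set 'rV[R]_d -> \bar R}) :
    charge_integral nu Omega (fun=> 0) = 0%E.
  by rewrite /charge_integral !integral0 sube0.
have vE (m' : 'I_d -> {charge set 'rV[R]_d -> \bar R}) :
    vector_integral m' Omega (fun x => eta x *: delta_mx 0 i) =
    charge_integral (m' i) Omega eta.
  rewrite /vector_integral (bigD1 i)//= big1 ?adde0; last first.
    move=> j /negbTE ji; rewrite -(ci0 (m' j)); congr charge_integral.
    by apply/funext => x; rewrite !mxE ji andbF mulr0.
  by congr charge_integral; apply/funext => x; rewrite !mxE !eqxx mulr1.
by rewrite -!vE -rep// -rep'.
Qed.
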